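(* Let $\alpha\ge0$ and let $f=h+\overline{g}\in\mathcal{W}^{0}_{\mathcal{H}}(\alpha)$ with $h(z)=z+\sum_{n=2}^\infty a_nz^n$, $g(z)=\sum_{n=2}^\infty b_nz^n$. Let $r_f$ be the unique root in $(0,1)$ of $$r+2\sum_{n=2}^{\infty}\frac{r^n}{\alpha n^2+n(1-\alpha)}=1+2\sum_{n=2}^{\infty}\frac{(-1)^{n-1}}{\alpha n^2+n(1-\alpha)}.$$ Then $$|z|+\sum_{n=2}^{\infty}(|a_n|+|b_n|)|z|^n\le d(f(0),\partial f(\mathbb{D}))\quad\text{for all }|z|\le r_f.$$ The radius $r_f$ is best possible: for $f_\alpha(z)=z+\sum_{n=2}^\infty\frac{2}{\alpha n^2+n(1-\alpha)}z^n\in\mathcal{W}^{0}_{\mathcal{H}}(\alpha)$, equality holds when $|z|=r_f$, and the inequality fails for every $|z|\in(r_f,1)$.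
   Context: $\mathbb{D}=\{z\in\mathbb{C}:|z|<1\}$. $\mathcal{H}_0$ denotes the class of harmonic functions $f=h+\overline{g}$ on $\mathbb{D}$, where $h,g$ are analytic in $\mathbb{D}$ of the form $h(z)=z+\sum_{n=2}^\infty a_nz^n$ and $g(z)=\sum_{n=2}^\infty b_nz^n$. For $\alpha\ge0$, $\mathcal{W}^{0}_{\mathcal{H}}(\alpha)$ is the set of $f=h+\overline{g}\in\mathcal{H}_0$ such that $\operatorname{Re}\big(h'(z)+\alpha zh''(z)\big)>|g'(z)+\alpha zg''(z)|$ for all $z\in\mathbb{D}$. For a function $f$ on $\mathbb{D}$, $d(f(0),\partial f(\mathbb{D}))=\inf\{|w-f(0)|: w\in\partial f(\mathbb{D})\}$ is the Euclidean distance from $f(0)$ to the boundary of $f(\mathbb{D})$. *)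

(* Defs.v *)
From Stdlib Require Import Reals.
From Coquelicot Require Import Coquelicot.
Open Scope R_scope.

Definition inD (z : C) : Prop := Cmod z < 1.

Definition Csum (u : nat -> C) : C :=
  (Series (fun n => Re (u n)), Series (fun n => Im (u n))).

(* Full Taylor coefficient sequences of h(z) = z + sum_{n>=2} a_n z^n
   and g(z) = sum_{n>=2} b_n z^n (only the values a n, b n for n >= 2 are used). *)
Definition hcoef (a : nat -> C) (n : nat) : C :=
  match n with 0%nat => RtoC 0 | 1%nat => RtoC 1 | _ => a n end.
Definition gcoef (b : nat -> C) (n : nat) : C :=
  match n with 0%nat | 1%nat => RtoC 0 | _ => b n end.

Definition hfun (a : nat -> C) (z : C) : C := Csum (fun n => Cmult (hcoef a n) (pow_n z n)).
Definition gfun (b : nat -> C) (z : C) : C := Csum (fun n => Cmult (gcoef b n) (pow_n z n)).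

Definition ffun (a b : nat -> C) (z : C) : C := Cplus (hfun a z) (Cconj (gfun b z)).

(* f = h + conj g is in H_0 : both power series converge on the whole disk
   (so h, g are analytic in D with the prescribed normalization). *)
Definition in_H0 (a b : nat -> C) : Prop :=
  forall z, inD z ->
    (exists l, is_series (fun n => Cmult (hcoef a n) (pow_n z n)) l) /\
    (exists l, is_series (fun n => Cmult (gcoef b n) (pow_n z n)) l).

Definition in_W0H (alpha : R) (a b : nat -> C) : Prop :=
  in_H0 a b /\
  exists h1 h2 g1 g2 : C -> C,
    (forall z, inD z ->
       is_derive (K := C_AbsRing) (hfun a) z (h1 z) /\
       is_derive (K := C_AbsRing) h1 z (h2 z) /\
       is_derive (K := C_AbsRing) (gfun b) z (g1 z) /\
       is_derive (K := C_AbsRing) g1 z (g2 z)) /\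
    (forall z, inD z ->
       Re (Cplus (h1 z) (Cmult (RtoC alpha) (Cmult z (h2 z))))
       > Cmod (Cplus (g1 z) (Cmult (RtoC alpha) (Cmult z (g2 z))))).

Definition image_D (f : C -> C) (w : C) : Prop := exists z, inD z /\ w = f z.
Definition on_boundary (S : C -> Prop) (w : C) : Prop :=
  forall eps, eps > 0 ->
    (exists s, S s /\ Cmod (Cminus s w) < eps) /\
    (exists t, ~ S t /\ Cmod (Cminus t w) < eps).

(* d(f(0), boundary f(D)) as an extended real (infimum, +oo if boundary empty). *)
Definition dist_bd (f : C -> C) : Rbar :=
  Glb_Rbar (fun x => exists w, on_boundary (image_D f) w /\ x = Cmod (Cminus w (f (RtoC 0)))).

Definition den (alpha : R) (n : nat) : R := alpha * INR n ^ 2 + INR n * (1 - alpha).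

Definition rf_eq (alpha r : R) : Prop :=
  r + 2 * Series (fun k => r ^ (k + 2) / den alpha (k + 2))
  = 1 + 2 * Series (fun k => (-1) ^ (k + 1) / den alpha (k + 2)).

Definition bohr_sum (a b : nat -> C) (r : R) : R :=
  r + Series (fun k => (Cmod (a (k + 2)%nat) + Cmod (b (k + 2)%nat)) * r ^ (k + 2)).

Definition a_ext (alpha : R) (n : nat) : C := RtoC (2 / den alpha n).
Definition b_ext (n : nat) : C := RtoC 0.

(* Main.v *)
(** For unimodular [eps] the function [F = h + eps g] satisfies [F'(0) = 1] and
    [p = F' + alpha z F''] has positive real part on the disk.  Pairing [p] with nonnegative
    trigonometric polynomials over roots of unity gives Caratheodory's bound [|p_n| <= 2], that is
    [|a_n| + |b_n| <= 2 / den alpha n], and Harnack's inequality [Re p >= (1 - |z|) / (1 + |z|)].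
    Along a ray, Harnack's inequality is a differential inequality for [Re F'], and comparison with
    the extremal function, for which it is an equality, yields [Re h' - |g'| >= psi(|z|) > 0];
    integrating, [|f(z)| >= growth(|z|)], which increases to the right-hand side [c] of the
    equation for the radius.

    The disk [|w| < c] lies in the image of [f]: following the segment from [0] to [w] in small
    steps, a minimiser of [|f - v|] over a closed disk [|z| <= r] cannot lie on the circle because
    of the growth bound, and [Re h' > |g'|] provides a descent direction unless [f = v].  So
    boundary points have modulus at least [c].  For the extremal function [-c] is the limit of
    [f(-r)] but is omitted, since [f] takes real values only on the real axis. *)
Require Import Defs.
From Stdlib Require Import Reals Lra Lia Classical ClassicalEpsilon.
From Coquelicot Require Import Coquelicot.
Open Scope R_scope.

(** * Complex power series on the unit disk *)

(** Roots of unity stand in for the Herglotz representation and for contour integrals: everything is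
    a finite sum, and the truncation error of [p] is absorbed in a constant term that tends to 0.
    Two test kernels suffice, [1 - u x^(-n)] for the coefficients and the Poisson kernel minus its
    minimum for Harnack's inequality.

    The differential inequality is compared at a minimum instead of being solved with an integrating
    factor, whose exponent [1 / alpha] would make [alpha = 0] a separate case.

    The growth bound says how large [|f|] is on circles, not which points are reached, and [f] is
    only harmonic, so analytic tools for images do not apply directly. A single minimisation started
    at [f(0) = 0] reaches only [|w| < growth(r) / 2], since the minimiser is kept off the circle by
    [|v| + |f(z) - v| < growth(r)]. Moving [v] along a segment, with the previous preimage as [z],
    removes the factor 2.

    The number [c] is the value at [r = 1] of a series that converges only conditionally when
    [alpha = 0]. In place of Abel's theorem, partial sums of alternating series enclose [growth] on
    [[0, 1)], and each of them is continuous at 1. *)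

Lemma re_le (z : C) : Re z <= Cmod z.
Proof. apply Rle_trans with (2 := re_le_Cmod z). apply Rle_abs. Qed.

Lemma re_ge (z : C) : - Cmod z <= Re z.
Proof. generalize (re_le_Cmod z). unfold Rabs. destruct (Rcase_abs (Re z)); lra. Qed.

Lemma im_le_Cmod (z : C) : Rabs (Im z) <= Cmod z.
Proof. apply Rle_trans with (2 := Rmax_Cmod z). apply Rmax_r. Qed.

Lemma C_eq (z w : C) : Re z = Re w -> Im z = Im w -> z = w.
Proof. destruct z, w. unfold Re, Im. simpl. congruence. Qed.

(** A modulus becomes the real part of a rotated number, which is linear. The triangle inequality
    for series, the coefficient bounds and the estimate of [|g'|] all reduce to real parts this
    way. *)
Lemma exists_unit_rotation (w : C) : exists u : C, Cmod u = 1 /\ (u * w = RtoC (Cmod w))%C.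
Proof.
  destruct (Ceq_dec w 0) as [->|Hw].
  - exists 1%C. rewrite Cmod_0, Cmod_1. split; [reflexivity|ring].
  - assert (H : Cmod w <> 0) by (intro E; apply Hw, Cmod_eq_0, E).
    assert (Hc : RtoC (Cmod w) <> 0) by (intro E; apply H; now injection E).
    exists (Cconj w / RtoC (Cmod w))%C. split.
    + rewrite Cmod_div, Cmod_conj, Cmod_R, Rabs_pos_eq by (assumption || apply Cmod_ge_0).
      now field.
    + generalize (Cmod2_conj w). rewrite RtoC_pow. intros E.
      transitivity ((w * Cconj w) / RtoC (Cmod w))%C; [now field|].
      rewrite <- E. now field.
Qed.

Definition Cabs_summable (u : nat -> C) : Prop := ex_series (fun n => Cmod (u n)).

Lemma Cabs_summable_re (u : nat -> C) : Cabs_summable u -> ex_series (fun n => Re (u n)).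
Proof. apply (ex_series_le (V := R_CompleteNormedModule)). intros n. apply re_le_Cmod. Qed.

Lemma Cabs_summable_im (u : nat -> C) : Cabs_summable u -> ex_series (fun n => Im (u n)).
Proof. apply (ex_series_le (V := R_CompleteNormedModule)). intros n. apply im_le_Cmod. Qed.

Lemma Cabs_summable_le (u : nat -> C) (v : nat -> R) :
  (forall n, Cmod (u n) <= v n) -> ex_series v -> Cabs_summable u.
Proof.
  intros H. apply (ex_series_le (V := R_CompleteNormedModule)). intros n.
  unfold norm; simpl; unfold abs; simpl. rewrite Rabs_pos_eq by apply Cmod_ge_0. apply H.
Qed.

Lemma Cabs_summable_scal (c : C) (u : nat -> C) :
  Cabs_summable u -> Cabs_summable (fun n => c * u n)%C.
Proof.
  intros Hu. apply Cabs_summable_le with (fun n => Cmod c * Cmod (u n)).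
  - intros n. rewrite Cmod_mult. lra.
  - exact (ex_series_scal (Cmod c) _ Hu).
Qed.

Lemma Csum_ext (u v : nat -> C) : (forall n, u n = v n) -> Csum u = Csum v.
Proof. intros H. unfold Csum. f_equal; apply Series_ext; intros n; now rewrite H. Qed.

Lemma Csum_plus (u v : nat -> C) : Cabs_summable u -> Cabs_summable v ->
  Csum (fun n => u n + v n)%C = (Csum u + Csum v)%C.
Proof.
  intros Hu Hv. apply C_eq; unfold Csum; simpl.
  - rewrite <- Series_plus by now apply Cabs_summable_re. reflexivity.
  - rewrite <- Series_plus by now apply Cabs_summable_im. reflexivity.
Qed.

Lemma Csum_scal (c : C) (u : nat -> C) : Cabs_summable u ->
  Csum (fun n => c * u n)%C = (c * Csum u)%C.
Proof.
  intros Hu. generalize (Cabs_summable_re u Hu) (Cabs_summable_im u Hu). intros Hr Hi.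
  apply C_eq; unfold Csum; simpl.
  - rewrite <- 2!Series_scal_l, <- Series_minus by (apply @ex_series_scal; assumption).
    reflexivity.
  - rewrite <- 2!Series_scal_l, <- Series_plus by (apply @ex_series_scal; assumption).
    reflexivity.
Qed.

Lemma Csum_minus (u v : nat -> C) : Cabs_summable u -> Cabs_summable v ->
  Csum (fun n => u n - v n)%C = (Csum u - Csum v)%C.
Proof.
  intros Hu Hv. transitivity (Csum u + (-1) * Csum v)%C; [|ring].
  rewrite <- Csum_scal, <- Csum_plus by (try apply Cabs_summable_scal; assumption).
  apply Csum_ext. intros n. ring.
Qed.

Lemma Csum_incr_1 (u : nat -> C) : Cabs_summable u ->
  Csum u = (u 0%nat + Csum (fun n => u (S n)))%C.
Proof.
  intros Hu. apply C_eq; unfold Csum; simpl.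
  - now rewrite Series_incr_1 by now apply Cabs_summable_re.
  - now rewrite Series_incr_1 by now apply Cabs_summable_im.
Qed.

Lemma Cmod_Csum (u : nat -> C) : Cabs_summable u ->
  Cmod (Csum u) <= Series (fun n => Cmod (u n)).
Proof.
  intros Hu. destruct (exists_unit_rotation (Csum u)) as [e [He E]].
  replace (Cmod (Csum u)) with (Re (e * Csum u)) by now rewrite E.
  rewrite <- Csum_scal by assumption. unfold Csum. simpl.
  apply Rle_trans with (1 := Rle_abs _).
  assert (Hs : ex_series (fun n => Rabs (Re (e * u n)))).
  { apply (ex_series_le (V := R_CompleteNormedModule)) with (2 := Hu). intros n.
    unfold norm; simpl; unfold abs; simpl. rewrite Rabs_Rabsolu.
    apply Rle_trans with (1 := re_le_Cmod (e * u n)). rewrite Cmod_mult, He. lra. }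
  apply Rle_trans with (1 := Series_Rabs _ Hs).
  apply Series_le; [|assumption]. intros n. split; [apply Rabs_pos|].
  apply Rle_trans with (1 := re_le_Cmod (e * u n)). rewrite Cmod_mult, He. lra.
Qed.

Lemma Csum_bound (u : nat -> C) (v : nat -> R) :
  (forall n, Cmod (u n) <= v n) -> ex_series v -> Cmod (Csum u) <= Series v.
Proof.
  intros H Hv. apply Rle_trans with (1 := Cmod_Csum u (Cabs_summable_le u v H Hv)).
  apply Series_le; [|assumption]. intros n. split; [apply Cmod_ge_0|apply H].
Qed.

(** Convertible to [hfun a] and [gfun b] for the coefficients [hcoef a] and [gcoef b], so results
    transfer by [change] or [reflexivity]. *)
Definition CPS (c : nat -> C) (z : C) : C := Csum (fun n => c n * z ^ n)%C.

(** The working form of analyticity on the disk: it depends on the moduli of the coefficients only,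
    so it passes to derivatives, sums and multiples by comparison. *)
Definition disk_summable (c : nat -> C) : Prop :=
  forall r, 0 <= r < 1 -> ex_series (fun n => Cmod (c n) * r ^ n).

Definition Cderiv_coef (c : nat -> C) (n : nat) : C := (RtoC (INR (S n)) * c (S n))%C.

Lemma CPS_summable (c : nat -> C) (z : C) : disk_summable c -> inD z ->
  Cabs_summable (fun n => c n * z ^ n)%C.
Proof.
  intros Hc Hz. apply Cabs_summable_le with (fun n => Cmod (c n) * Cmod z ^ n).
  - intros n. rewrite Cmod_mult, Cmod_pow. lra.
  - apply Hc. split; [apply Cmod_ge_0|exact Hz].
Qed.

Lemma disk_summable_le (c : nat -> C) (d : nat -> C) :
  (forall n, Cmod (c n) <= Cmod (d n)) -> disk_summable d -> disk_summable c.
Proof.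
  intros H Hd r Hr. apply (ex_series_le (V := R_CompleteNormedModule)) with (2 := Hd r Hr).
  intros n. unfold norm; simpl; unfold abs; simpl.
  assert (0 <= r ^ n) by (apply pow_le; lra). generalize (Cmod_ge_0 (c n)) (H n). intros.
  rewrite Rabs_pos_eq by nra. nra.
Qed.

Lemma disk_summable_plus (c d : nat -> C) :
  disk_summable c -> disk_summable d -> disk_summable (fun n => c n + d n)%C.
Proof.
  intros Hc Hd r Hr.
  apply (ex_series_le (V := R_CompleteNormedModule))
    with (2 := ex_series_plus _ _ (Hc r Hr) (Hd r Hr)).
  intros n. unfold norm, plus; simpl; unfold abs; simpl.
  assert (0 <= r ^ n) by (apply pow_le; lra). generalize (Cmod_ge_0 (c n + d n)) (Cmod_triangle (c n) (d n)). intros.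
  rewrite Rabs_pos_eq by nra. nra.
Qed.

Lemma disk_summable_scal (k : C) (c : nat -> C) :
  disk_summable c -> disk_summable (fun n => k * c n)%C.
Proof.
  intros Hc r Hr. apply ex_series_ext with (fun n => scal (Cmod k) (Cmod (c n) * r ^ n)).
  - intros n. rewrite Cmod_mult. unfold scal; simpl; unfold mult; simpl. ring.
  - exact (ex_series_scal (Cmod k) _ (Hc r Hr)).
Qed.

(** A bound at the intermediate radius [(1 + r) / 2] leaves a geometric series of ratio [q] at
    radius [r]. *)
Lemma disk_summable_bounded (c : nat -> C) :
  (forall r, 0 <= r < 1 -> exists M, forall n, Cmod (c n) * r ^ n <= M) -> disk_summable c.
Proof.
  intros H r Hr. destruct (H ((1 + r) / 2)) as [M HM]; [lra|].
  set (q := r / ((1 + r) / 2)).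
  assert (Hq : 0 <= q < 1).
  { unfold q. split. apply Rdiv_le_0_compat; lra.
    apply Rmult_lt_reg_r with ((1 + r) / 2); [lra|]. field_simplify; lra. }
  apply (ex_series_le (V := R_CompleteNormedModule)) with (fun n => M * q ^ n).
  - intros n. unfold norm; simpl; unfold abs; simpl.
    replace (r ^ n) with (((1 + r) / 2) ^ n * q ^ n)
      by (rewrite <- Rpow_mult_distr; f_equal; unfold q; field; lra).
    assert (0 <= q ^ n) by (apply pow_le; lra).
    assert (0 <= ((1 + r) / 2) ^ n) by (apply pow_le; lra).
    generalize (Cmod_ge_0 (c n)) (HM n). intros.
    rewrite Rabs_pos_eq.
    + rewrite <- Rmult_assoc. now apply Rmult_le_compat_r.
    + apply Rmult_le_pos; [assumption|]. now apply Rmult_le_pos.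
  - apply (ex_series_scal M (fun n => q ^ n)). apply ex_series_geom.
    rewrite Rabs_pos_eq; lra.
Qed.


Lemma eventually_bounded (u : nat -> R) (N : nat) (M : R) :
  (forall n, (N <= n)%nat -> u n <= M) -> exists M', forall n, u n <= M'.
Proof.
  revert M. induction N as [|N IH]; intros M H.
  - exists M. intros n. apply H. lia.
  - apply (IH (Rmax M (u N))). intros n Hn.
    destruct (Nat.eq_dec n N) as [->|Hne]; [apply Rmax_r|].
    apply Rle_trans with (2 := Rmax_l _ _). apply H. lia.
Qed.

Lemma disk_summable_of_series (c : nat -> C) :
  (forall z, inD z -> exists l, is_series (fun n => c n * z ^ n)%C l) ->
  disk_summable c.
Proof.
  intros H. apply disk_summable_bounded. intros r Hr.
  destruct (H (RtoC r)) as [l Hl].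
  { unfold inD. rewrite Cmod_R, Rabs_pos_eq; lra. }
  destruct (Hl (fun x => ball l 1 x)) as [N HN].
  { exists (mkposreal 1 Rlt_0_1). intros y Hy. exact Hy. }
  (* A term is the difference of two partial sums close to [l]. Balls of [C] are products of
     intervals, so radius 1 gives a modulus below [sqrt 2] for each. *)
  apply eventually_bounded with (S N) (2 * sqrt 2).
  intros [|n] Hn; [lia|].
  generalize (C_NormedModule_mixin_compat2 _ _ (mkposreal 1 Rlt_0_1) (HN n ltac:(lia)))
    (C_NormedModule_mixin_compat2 _ _ (mkposreal 1 Rlt_0_1) (HN (S n) ltac:(lia))).
  rewrite sum_Sn. set (s := sum_n _ n).
  unfold minus, plus, opp; simpl. fold Copp. intros H1 H2.
  replace (Cmod (c (S n)) * (r * r ^ n)) with (Cmod (c (S n) * RtoC r ^ S n))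
    by (rewrite Cmod_mult, Cmod_pow, Cmod_R, (Rabs_pos_eq r) by lra; reflexivity).
  replace (c (S n) * RtoC r ^ S n)%C
    with ((s + c (S n) * (r * r ^ n) + - l) + - (s + - l))%C by (simpl; ring).
  apply Rle_trans with (1 := Cmod_triangle _ _). rewrite Cmod_opp. lra.
Qed.

(** The moduli form a real power series whose radius is at least [(1 + r) / 2], and differentiation
    preserves the radius of convergence. *)
Lemma disk_summable_deriv (c : nat -> C) : disk_summable c -> disk_summable (Cderiv_coef c).
Proof.
  intros Hc r Hr. set (a := fun n => Cmod (c n)).
  assert (Hrad : Rbar_lt (Rabs r) (CV_radius a)).
  { rewrite Rabs_pos_eq by lra.
    apply Rbar_lt_le_trans with ((1 + r) / 2); [simpl; lra|].
    apply (proj1 (CV_radius_bounded a)).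
    destruct (ex_series_lim_0 _ (Hc ((1 + r) / 2) ltac:(lra)) (fun x => Rabs x < 1)) as [N HN].
    { exists (mkposreal 1 Rlt_0_1). intros y Hy.
      unfold ball in Hy; simpl in Hy; unfold AbsRing_ball, abs, minus, plus, opp in Hy; simpl in Hy.
      now rewrite Ropp_0, Rplus_0_r in Hy. }
    apply eventually_bounded with N 1. intros n Hn. left. now apply HN. }
  rewrite <- CV_radius_derive in Hrad.
  apply ex_series_ext with (2 := CV_disk_inside _ _ Hrad).
  intros n. unfold PS_derive, a, Cderiv_coef. rewrite Rabs_pos_eq.
  - now rewrite Cmod_mult, Cmod_R, Rabs_pos_eq by apply pos_INR.
  - apply Rmult_le_pos; [apply Rmult_le_pos|]; [apply pos_INR|apply Cmod_ge_0|apply pow_le; lra].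
Qed.

(** * Complex derivatives, their restriction to lines, and termwise differentiation *)

Lemma is_derive_C_of_bound (f : C -> C) (z l : C) (d M : R) : 0 < d ->
  (forall k, Cmod k < d -> Cmod (f (z + k)%C - f z - k * l)%C <= M * Cmod k ^ 2) ->
  is_derive (K := C_AbsRing) f z l.
Proof.
  intros Hd H. split.
  - apply (@is_linear_scal_l C_AbsRing C_NormedModule).
  - intros x Hx.
    assert (E : z = x) by exact (@is_filter_lim_locally_unique C_AbsRing (AbsRing_NormedModule C_AbsRing) z x Hx).
    subst x. intros eps.
    set (e := Rmin d (eps / (Rabs M + 1))).
    assert (HM : 0 < Rabs M + 1) by (generalize (Rabs_pos M); lra).
    assert (He : 0 < e).
    { apply Rmin_glb_lt; [assumption|]. apply Rdiv_lt_0_compat; [apply cond_pos|assumption]. }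
    exists (mkposreal e He). intros y Hy.
    assert (Hy' : Cmod (y - z) < e) by exact Hy.
    change (Cmod ((f y - f z) - (y - z) * l)%C <= eps * Cmod (y - z)%C).
    set (k := (y - z)%C) in *.
    replace y with (z + k)%C by (unfold k; ring).
    apply Rle_trans with (1 := H k (Rlt_le_trans _ _ _ Hy' (Rmin_l _ _))).
    assert (Hk : Cmod k <= eps / (Rabs M + 1)) by (left; apply (Rlt_le_trans _ _ _ Hy' (Rmin_r _ _))).
    assert (Hk2 : Cmod k * (Rabs M + 1) <= eps).
    { apply Rmult_le_reg_r with (/ (Rabs M + 1)); [now apply Rinv_0_lt_compat|].
      rewrite Rmult_assoc, Rinv_r, Rmult_1_r by lra. exact Hk. }
    generalize (Cmod_ge_0 k) (Rle_abs M). nra.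
Qed.

Lemma is_derive_C_eps (f : C -> C) (z l : C) : is_derive (K := C_AbsRing) f z l ->
  forall eps : posreal, exists d : posreal, forall k, Cmod k < d ->
    Cmod (f (z + k)%C - f z - k * l)%C <= eps * Cmod k.
Proof.
  intros [_ H] eps. destruct (H z (fun P HP => HP) eps) as [d Hd].
  exists d. intros k Hk. specialize (Hd (z + k)%C).
  assert (E : ((z + k) - z)%C = k) by ring.
  change (Cmod ((z + k) - z)%C < d ->
    Cmod ((f (z + k) - f z) - ((z + k) - z) * l)%C <= eps * Cmod ((z + k) - z)%C) in Hd.
  rewrite E in Hd. now apply Hd.
Qed.

(** The weight [w] selects a real-linear functional: 1 gives the real part, [- Ci] the imaginary
    part, and [Cconj e] the component along the ray of direction [e]. *)
Lemma is_derive_line (f : C -> C) (z e l w : C) (t : R) :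
  is_derive (K := C_AbsRing) f (z + RtoC t * e)%C l ->
  is_derive (fun s : R => Re (w * f (z + RtoC s * e)%C)) t (Re (w * (e * l))).
Proof.
  intros H. split; [apply is_linear_scal_l|].
  intros x Hx. assert (E : t = x) by exact (is_filter_lim_locally_unique t x Hx). subst x.
  intros eps.
  assert (HM : 0 < Cmod w * Cmod e + 1) by (generalize (Cmod_ge_0 w) (Cmod_ge_0 e); nra).
  assert (He : 0 < eps / (Cmod w * Cmod e + 1)) by (apply Rdiv_lt_0_compat; [apply cond_pos|assumption]).
  destruct (is_derive_C_eps _ _ _ H (mkposreal _ He)) as [d Hd]. simpl in Hd.
  assert (Hd' : 0 < d / (Cmod e + 1)).
  { apply Rdiv_lt_0_compat; [apply cond_pos|]. generalize (Cmod_ge_0 e); lra. }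
  exists (mkposreal _ Hd'). intros s Hs.
  assert (Hs' : Rabs (s - t) < d / (Cmod e + 1)) by exact Hs.
  change (Rabs (Re (w * f (z + s * e)%C) - Re (w * f (z + t * e)%C) - (s - t) * Re (w * (e * l)))
    <= eps * Rabs (s - t)).
  set (k := (RtoC (s - t) * e)%C).
  assert (Hk : Cmod k = Rabs (s - t) * Cmod e) by (unfold k; now rewrite Cmod_mult, Cmod_R).
  assert (Hkd : Cmod k < d).
  { rewrite Hk. apply Rmult_lt_compat_r with (r := Cmod e + 1) in Hs'; [|generalize (Cmod_ge_0 e); lra].
    replace (d / (Cmod e + 1) * (Cmod e + 1)) with (pos d) in Hs' by (field; generalize (Cmod_ge_0 e); lra).
    generalize (Rabs_pos (s - t)). nra. }
  specialize (Hd k Hkd).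
  replace (z + t * e + k)%C with (z + s * e)%C in Hd by (unfold k; rewrite RtoC_minus; ring).
  replace (Re (w * f (z + s * e)%C) - Re (w * f (z + t * e)%C) - (s - t) * Re (w * (e * l)))
    with (Re (w * (f (z + s * e)%C - f (z + t * e)%C - k * l))).
  2:{ unfold k. destruct w, e, l, (f _), (f _). simpl. ring. }
  apply Rle_trans with (1 := re_le_Cmod _). rewrite Cmod_mult.
  apply Rle_trans with (Cmod w * (eps / (Cmod w * Cmod e + 1) * Cmod k)).
  { apply Rmult_le_compat_l; [apply Cmod_ge_0|assumption]. }
  rewrite Hk.
  replace (Cmod w * (eps / (Cmod w * Cmod e + 1) * (Rabs (s - t) * Cmod e)))
    with ((eps / (Cmod w * Cmod e + 1) * (Cmod w * Cmod e)) * Rabs (s - t)) by ring.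
  apply Rmult_le_compat_r; [apply Rabs_pos|].
  apply Rle_trans with (eps / (Cmod w * Cmod e + 1) * (Cmod w * Cmod e + 1)); [nra|].
  right. field. lra.
Qed.

Lemma Cpow_diff_bound (z k : C) (rho : R) (n : nat) :
  Cmod z <= rho -> Cmod (z + k) <= rho ->
  Cmod ((z + k) ^ S n - z ^ S n) <= INR (S n) * Cmod k * rho ^ n.
Proof.
  intros Hz Hzk. induction n as [|n IH].
  - replace ((z + k) ^ 1 - z ^ 1)%C with k by (simpl; ring). simpl. lra.
  - replace ((z + k) ^ S (S n) - z ^ S (S n))%C
      with ((z + k) * ((z + k) ^ S n - z ^ S n) + k * z ^ S n)%C by (rewrite !(Cpow_S _ (S n)); ring).
    apply Rle_trans with (1 := Cmod_triangle _ _). rewrite !Cmod_mult, Cmod_pow.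
    assert (Hp : Cmod z ^ S n <= rho ^ S n) by (apply pow_incr; split; [apply Cmod_ge_0|assumption]).
    assert (0 <= rho ^ n) by (apply pow_le; generalize (Cmod_ge_0 z); lra).
    assert (0 <= INR (S n) * Cmod k * rho ^ n).
    { apply Rmult_le_pos; [apply Rmult_le_pos|]; [apply pos_INR|apply Cmod_ge_0|assumption]. }
    apply Rle_trans with (rho * (INR (S n) * Cmod k * rho ^ n) + Cmod k * rho ^ S n).
    + apply Rplus_le_compat.
      * apply Rmult_le_compat; try apply Cmod_ge_0; assumption.
      * apply Rmult_le_compat_l; [apply Cmod_ge_0|assumption].
    + rewrite (S_INR (S n)). simpl. right. ring.
Qed.

(** The factor [(n + 2)(n + 1)] is that of the second derivative, so summation against the
    coefficients gives exactly the series of moduli of the second derivative at radius [rho]. *)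
Lemma Cpow_taylor_bound (z k : C) (rho : R) (n : nat) :
  Cmod z <= rho -> Cmod (z + k) <= rho ->
  Cmod ((z + k) ^ S (S n) - z ^ S (S n) - k * (RtoC (INR (S (S n))) * z ^ S n))
    <= INR (S (S n)) * INR (S n) * Cmod k ^ 2 * rho ^ n.
Proof.
  intros Hz Hzk.
  assert (Hr : 0 <= rho) by (generalize (Cmod_ge_0 z); lra).
  induction n as [|n IH].
  - replace ((z + k) ^ 2 - z ^ 2 - k * (RtoC (INR 2) * z ^ 1))%C with (k ^ 2)%C
      by (simpl; replace (RtoC (1 + 1)) with (2:C) by (f_equal; ring); ring).
    rewrite Cmod_pow. simpl. generalize (pow2_ge_0 (Cmod k)). simpl. lra.
  - replace ((z + k) ^ S (S (S n)) - z ^ S (S (S n)) - k * (RtoC (INR (S (S (S n)))) * z ^ S (S n)))%C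
      with (z * ((z + k) ^ S (S n) - z ^ S (S n) - k * (RtoC (INR (S (S n))) * z ^ S n))
            + k * ((z + k) ^ S (S n) - z ^ S (S n)))%C
      by (rewrite (S_INR (S (S n))), RtoC_plus, !(Cpow_S _ (S (S n))), !(Cpow_S z (S n)); ring).
    apply Rle_trans with (1 := Cmod_triangle _ _). rewrite !Cmod_mult.
    generalize (Cpow_diff_bound z k rho (S n) Hz Hzk). intros Hd.
    assert (0 <= rho ^ n) by (apply pow_le; lra).
    apply Rle_trans with (rho * (INR (S (S n)) * INR (S n) * Cmod k ^ 2 * rho ^ n)
      + Cmod k * (INR (S (S n)) * Cmod k * rho ^ S n)).
    + apply Rplus_le_compat.
      * apply Rmult_le_compat; try apply Cmod_ge_0; assumption.
      * apply Rmult_le_compat_l; [apply Cmod_ge_0|assumption].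
    + rewrite (S_INR (S (S n))), (S_INR (S n)).
      assert (0 <= INR (S n)) by apply pos_INR.
      assert (0 <= Cmod k ^ 2 * rho ^ S n) by (apply Rmult_le_pos; [apply pow2_ge_0|apply pow_le; lra]).
      replace (rho * ((INR (S n) + 1) * INR (S n) * Cmod k ^ 2 * rho ^ n)
        + Cmod k * ((INR (S n) + 1) * Cmod k * rho ^ S n))
        with ((INR (S n) + 1) * (INR (S n) + 1) * (Cmod k ^ 2 * rho ^ S n)) by (simpl; ring).
      replace ((INR (S n) + 1 + 1) * (INR (S n) + 1) * Cmod k ^ 2 * rho ^ S n)
        with ((INR (S n) + 1 + 1) * (INR (S n) + 1) * (Cmod k ^ 2 * rho ^ S n)) by ring.
      apply Rmult_le_compat_r; [assumption|nra].
Qed.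

Lemma is_derive_CPS (c : nat -> C) (z : C) : disk_summable c -> inD z ->
  is_derive (K := C_AbsRing) (CPS c) z (CPS (Cderiv_coef c) z).
Proof.
  intros Hc Hz. unfold inD in Hz.
  set (rho := (1 + Cmod z) / 2).
  assert (Hrho : Cmod z < rho < 1) by (unfold rho; lra).
  assert (Hr0 : 0 <= rho) by (generalize (Cmod_ge_0 z); lra).
  assert (Hc1 := disk_summable_deriv c Hc). assert (Hc2 := disk_summable_deriv _ Hc1).
  set (v := fun n => Cmod (Cderiv_coef (Cderiv_coef c) n) * rho ^ n).
  assert (Hv : ex_series v) by (apply Hc2; lra).
  apply is_derive_C_of_bound with (rho - Cmod z) (Series v); [lra|].
  intros k Hk.
  assert (Hzk : Cmod (z + k) <= rho) by (generalize (Cmod_triangle z k); lra).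
  assert (S0 := CPS_summable c z Hc Hz).
  assert (S1 := CPS_summable c (z + k)%C Hc ltac:(unfold inD; lra)).
  assert (S2 := CPS_summable _ z Hc1 Hz).
  unfold CPS.
  rewrite <- Csum_scal by assumption.
  rewrite (Csum_incr_1 _ S0), (Csum_incr_1 _ S1).
  assert (S0' := proj1 (ex_series_incr_1 _) S0). assert (S1' := proj1 (ex_series_incr_1 _) S1).
  replace (c 0%nat * (z + k) ^ 0 + Csum (fun n => c (S n) * (z + k) ^ S n)
     - (c 0%nat * z ^ 0 + Csum (fun n => c (S n) * z ^ S n))
     - Csum (fun n => k * (Cderiv_coef c n * z ^ n)))%C
    with (Csum (fun n => c (S n) * (z + k) ^ S n) - Csum (fun n => c (S n) * z ^ S n)
     - Csum (fun n => k * (Cderiv_coef c n * z ^ n)))%C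
    by (repeat match goal with |- context [Csum ?u] => generalize (Csum u); intro end;
        ring).
  assert (S2' := Cabs_summable_scal k _ S2).
  rewrite <- (Csum_minus _ _ S1' S0').
  assert (S3 : Cabs_summable (fun n => c (S n) * (z + k) ^ S n - c (S n) * z ^ S n)%C).
  { apply (Cabs_summable_le _ (fun n => Cmod (c (S n) * (z + k) ^ S n) + Cmod (c (S n) * z ^ S n))).
    - intros n. apply Rle_trans with (1 := Cmod_triangle _ _). rewrite Cmod_opp. lra.
    - exact (ex_series_plus _ _ S1' S0'). }
  rewrite <- (Csum_minus _ _ S3 S2').
  (* The contribution of [c 1] cancels exactly; what remains starts in degree two, where
     [Cpow_taylor_bound] applies. *)
  rewrite Csum_incr_1.
  2:{ apply (Cabs_summable_le _ (fun n => Cmod (c (S n) * (z + k) ^ S n - c (S n) * z ^ S n)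
         + Cmod (k * (Cderiv_coef c n * z ^ n)))).
    - intros n. apply Rle_trans with (1 := Cmod_triangle _ _). rewrite Cmod_opp. lra.
    - exact (ex_series_plus _ _ S3 S2'). }
  rewrite Rmult_comm, <- Series_scal_l.
  match goal with |- Cmod (?x + ?y) <= _ => replace x with (RtoC 0) end.
  2:{ unfold Cderiv_coef. simpl. ring. }
  rewrite Cplus_0_l. apply Csum_bound.
  - intros n. unfold v.
    replace (c (S (S n)) * (z + k) ^ S (S n) - c (S (S n)) * z ^ S (S n) - k * (Cderiv_coef c (S n) * z ^ S n))%C
      with (c (S (S n)) * ((z + k) ^ S (S n) - z ^ S (S n) - k * (RtoC (INR (S (S n))) * z ^ S n)))%C
      by (unfold Cderiv_coef; ring).
        rewrite Cmod_mult. unfold Cderiv_coef. rewrite !Cmod_mult, !Cmod_R, !Rabs_pos_eq by apply pos_INR.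
    apply Rle_trans with (Cmod (c (S (S n))) * (INR (S (S n)) * INR (S n) * Cmod k ^ 2 * rho ^ n)).
    + apply Rmult_le_compat_l; [apply Cmod_ge_0|]. apply Cpow_taylor_bound; lra.
    + right. ring.
  - exact (ex_series_scal (Cmod k ^ 2) v Hv).
Qed.

(** * Functions with positive real part *)

(** Goals about [sum_n] are typed in the carrier of an abstract monoid; the [change] restores [C],
    which [ring] recognises. *)
Ltac Cring := match goal with |- @eq _ ?a ?b => change (@eq C a b) end; ring.

Lemma Csum_n_S (u : nat -> C) (n : nat) : sum_n u (S n) = (sum_n u n + u (S n))%C :> C.
Proof. exact (sum_Sn u n). Qed.

Lemma Csum_n_mult_l (a : C) (u : nat -> C) (n : nat) :
  sum_n (fun k => a * u k)%C n = (a * sum_n u n)%C :> C.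
Proof. exact (sum_n_mult_l (K := C_Ring) a u n). Qed.

Lemma Csum_n_prod (u v : nat -> C) (m n : nat) :
  (sum_n u m * sum_n v n)%C = sum_n (fun i => sum_n (fun j => u i * v j)%C n) m.
Proof.
  transitivity (sum_n (fun i => u i * sum_n v n)%C m).
  - symmetry. exact (sum_n_mult_r (K := C_Ring) (sum_n v n) u m).
  - apply sum_n_ext. intros i. symmetry. apply Csum_n_mult_l.
Qed.

Lemma re_sum_n (u : nat -> C) (n : nat) : Re (sum_n u n) = sum_n (fun k => Re (u k)) n.
Proof.
  induction n as [|n IH]; [now rewrite !sum_O|].
  rewrite Csum_n_S, re_plus, IH. symmetry. apply (sum_Sn (G := R_AbelianMonoid)).
Qed.

Lemma Cconj_sum_n (u : nat -> C) (n : nat) :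
  Cconj (sum_n u n) = sum_n (fun k => Cconj (u k)) n.
Proof.
  induction n as [|n IH]; [now rewrite !sum_O|].
  rewrite !Csum_n_S, <- IH. apply Cplus_conj.
Qed.

Lemma sum_n_nonneg (u : nat -> R) (n : nat) : (forall k, 0 <= u k) -> 0 <= sum_n u n.
Proof.
  intros H. induction n as [|n IH]; [rewrite sum_O; apply H|].
  rewrite sum_Sn. apply Rplus_le_le_0_compat; auto.
Qed.

Lemma Csum_n_zero (u : nat -> C) (n : nat) : (forall k, (k <= n)%nat -> u k = RtoC 0) -> sum_n u n = RtoC 0 :> C.
Proof.
  induction n as [|n IH]; intros H; [rewrite sum_O; apply H; lia|].
  rewrite Csum_n_S, IH, H by (intros; auto with arith). ring.
Qed.

Lemma Csum_n_single (u : nat -> C) (m n : nat) : (m <= n)%nat ->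
  (forall k, (k <= n)%nat -> k <> m -> u k = RtoC 0) -> sum_n u n = u m :> C.
Proof.
  induction n as [|n IH]; intros Hm H.
  - rewrite sum_O. now replace m with 0%nat by lia.
  - rewrite Csum_n_S. destruct (Nat.eq_dec m (S n)) as [->|Hne].
    + rewrite Csum_n_zero by (intros; apply H; lia). ring.
    + rewrite IH by (try lia; intros; apply H; lia).
      rewrite (H (S n)) by lia. ring.
Qed.

Lemma Cgeom_sum (w : C) (n : nat) : ((w - 1) * sum_n (fun j => w ^ j)%C n = w ^ S n - 1)%C.
Proof.
  induction n as [|n IH]; [rewrite sum_O; simpl; ring|].
  rewrite Csum_n_S, Cmult_plus_distr_l, IH. simpl. ring.
Qed.

Lemma Csum_n_root_of_unity (w : C) (n : nat) : (w ^ S n = 1)%C -> w <> 1%C ->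
  sum_n (fun j => w ^ j)%C n = RtoC 0 :> C.
Proof.
  intros H1 Hw. generalize (Cgeom_sum w n). rewrite H1. intros E.
  apply (f_equal (fun x => / (w - 1) * x)%C) in E.
  assert (Hw' : (w - 1)%C <> 0%C).
  { intros E'. apply Hw. replace w with ((w - 1) + 1)%C by ring. rewrite E'. ring. }
  rewrite Cmult_assoc, Cinv_l, Cmult_1_l in E by assumption. rewrite E. ring.
Qed.

Lemma Csum_n_one (n : nat) : sum_n (fun _ => RtoC 1) n = RtoC (INR (S n)) :> C.
Proof.
  induction n as [|n IH]; [now rewrite sum_O|].
  now rewrite Csum_n_S, IH, <- RtoC_plus, (S_INR (S n)).
Qed.

(** * Roots of unity and discrete orthogonality *)

Definition Ccis (x : R) : C := (cos x, sin x).

Lemma Ccis_pow (x : R) (n : nat) : (Ccis x ^ n)%C = Ccis (INR n * x).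
Proof.
  induction n as [|n IH].
  - unfold Ccis. simpl. now rewrite Rmult_0_l, cos_0, sin_0.
  - rewrite Cpow_S, IH, S_INR. unfold Ccis, Cmult; simpl.
    replace ((INR n + 1) * x) with (x + INR n * x) by ring.
    rewrite cos_plus, sin_plus. f_equal; ring.
Qed.

Lemma Cmod_Ccis (x : R) : Cmod (Ccis x) = 1.
Proof.
  unfold Cmod, Ccis. simpl fst; simpl snd. rewrite <- sqrt_1. f_equal.
  generalize (sin2_cos2 x). unfold Rsqr. simpl. lra.
Qed.

Lemma Ccis_conj_r (x : R) : (Ccis x * Cconj (Ccis x))%C = 1%C.
Proof. rewrite <- Cmod2_conj, Cmod_Ccis. now rewrite pow1. Qed.

(** The half angle lies strictly between 0 and [PI], where the sine is positive, and
    [cos x = 1 - 2 sin(x / 2)^2]. *)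
Lemma Ccis_primitive (N k : nat) : (0 < k <= N)%nat ->
  (Ccis (2 * PI / INR (S N)) ^ k)%C <> 1%C.
Proof.
  intros Hk E. rewrite Ccis_pow in E.
  set (x := INR k * (2 * PI / INR (S N))) in E.
  assert (HN : 0 < INR (S N)) by (apply lt_0_INR; lia).
  assert (Hk0 : 0 < INR k) by (apply lt_0_INR; lia).
  assert (HkN : INR k < INR (S N)) by (apply lt_INR; lia).
  assert (Hx : 0 < x / 2 < PI).
  { generalize PI_RGT_0. intros HP. unfold x. split.
    - apply Rdiv_lt_0_compat; [|lra]. apply Rmult_lt_0_compat; [assumption|].
      apply Rdiv_lt_0_compat; lra.
    - apply Rmult_lt_reg_r with (INR (S N)); [assumption|].
      replace (INR k * (2 * PI / INR (S N)) / 2 * INR (S N)) with (PI * INR k) by (field; lra).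
      now apply Rmult_lt_compat_l. }
  assert (Hs := sin_gt_0 _ (proj1 Hx) (proj2 Hx)).
  injection E as Ec _.
  replace x with (2 * (x / 2)) in Ec by field. rewrite cos_2a_sin in Ec. nra.
Qed.

Lemma Ccis_full (N : nat) : (Ccis (2 * PI / INR (S N)) ^ S N)%C = 1%C.
Proof.
  rewrite Ccis_pow. replace (INR (S N) * (2 * PI / INR (S N))) with (2 * PI)
    by (field; apply not_0_INR; lia).
  unfold Ccis. now rewrite cos_2PI, sin_2PI.
Qed.

Lemma Cpow_swap (w : C) (i j : nat) : ((w ^ i) ^ j = (w ^ j) ^ i)%C.
Proof. now rewrite <- !Cpow_mult_r, Nat.mul_comm. Qed.

(** With [2 M + 1] nodes the exponents [m + n], at most [2 M], stay below the order of the root, as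
    do the differences in [roots_orthogonal_conj]. There is no aliasing, and the average over the
    nodes acts on these products like the integral over the circle. *)
Lemma roots_orthogonal_mult (M m n : nat) (N := (2 * M)%nat) (w := Ccis (2 * PI / INR (S N))) : (m <= M)%nat -> (n <= M)%nat -> (0 < m + n)%nat ->
  sum_n (fun j => (w ^ j) ^ m * (w ^ j) ^ n)%C N = RtoC 0 :> C.
Proof.
  intros Hm Hn Hmn.
  rewrite (sum_n_ext _ (fun j => (w ^ (m + n)) ^ j)%C).
  - apply Csum_n_root_of_unity.
    + rewrite Cpow_swap. unfold w. rewrite Ccis_full. apply Cpow_1_l.
    + apply Ccis_primitive. unfold N. lia.
  - intros j. rewrite <- Cpow_add_r. apply Cpow_swap.
Qed.

Lemma roots_orthogonal_conj (M m n : nat) (N := (2 * M)%nat) (w := Ccis (2 * PI / INR (S N))) : (m <= M)%nat -> (n <= M)%nat -> m <> n ->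
  sum_n (fun j => (w ^ j) ^ m * Cconj (w ^ j) ^ n)%C N = RtoC 0 :> C.
Proof.
  intros Hm Hn Hmn.
  rewrite (sum_n_ext _ (fun j => (w ^ m * Cconj w ^ n) ^ j)%C).
  2:{ intros j. rewrite Cpow_conj, Cpow_mult_l. f_equal; apply Cpow_swap. }
  apply Csum_n_root_of_unity.
  - rewrite Cpow_mult_l, 2!(Cpow_swap _ _ (S N)), <- Cpow_conj.
    unfold w. rewrite Ccis_full.
    replace (Cconj (RtoC 1)) with (RtoC 1) by (apply C_eq; simpl; ring). rewrite !Cpow_1_l. ring.
  - intros E.
    assert (E2 : (w ^ m = w ^ n)%C).
    { replace (w ^ n)%C with ((w ^ m * Cconj w ^ n) * w ^ n)%C by (rewrite E; ring).
      rewrite <- Cmult_assoc, <- Cpow_mult_l, (Cmult_comm (Cconj w)). unfold w at 3 4.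
      rewrite Ccis_conj_r, Cpow_1_l. ring. }
    assert (Hw : forall k, (w ^ k)%C <> 0%C).
    { intros k. apply Cpow_nz. intros E0. generalize (Cmod_Ccis (2 * PI / INR (S N))).
      fold w. rewrite E0, Cmod_0. lra. }
    destruct (Nat.lt_ge_cases m n) as [Hlt|Hge].
    + apply (Ccis_primitive N (n - m)); [unfold N; lia|]. fold w.
      replace n with (m + (n - m))%nat in E2 by lia. rewrite Cpow_add_r in E2.
      transitivity (/ w ^ m * (w ^ m * w ^ (n - m)))%C.
      * now field.
      * rewrite <- E2. now field.
    + apply (Ccis_primitive N (m - n)); [unfold N; lia|]. fold w.
      replace m with (n + (m - n))%nat in E2 by lia. rewrite Cpow_add_r in E2.
      transitivity (/ w ^ n * (w ^ n * w ^ (m - n)))%C.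
      * now field.
      * rewrite E2. now field.
Qed.

(** Averaging over the nodes, [P Q] leaves the sum of the [q n * k n], and [P] times the conjugate
    of [Q] leaves only the product of the constant terms. The real parts of these two products add
    up to [2 Re P Re Q], which is nonnegative at every node. *)
Lemma positive_pairing (M : nat) (q k : nat -> C) :
  (forall x, Cmod x = 1 -> 0 <= Re (sum_n (fun m => q m * x ^ m)%C M)) ->
  (forall x, Cmod x = 1 -> 0 <= Re (sum_n (fun n => k n * Cconj x ^ n)%C M)) ->
  0 <= Re (sum_n (fun n => q n * k n)%C M) + Re (q 0%nat * Cconj (k 0%nat)).
Proof.
  intros HP HQ. set (N := (2 * M)%nat). set (w := Ccis (2 * PI / INR (S N))).
  set (P := fun x => sum_n (fun m => q m * x ^ m)%C M).
  set (Q := fun x => sum_n (fun n => k n * Cconj x ^ n)%C M).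
  assert (HN : 0 < INR (S N)) by (apply lt_0_INR; lia).
  assert (E1 : sum_n (fun j => P (w ^ j) * Q (w ^ j))%C N
    = (RtoC (INR (S N)) * sum_n (fun n => q n * k n)%C M)%C :> C).
  { rewrite (sum_n_ext _ (fun j => sum_n (fun m => sum_n (fun n =>
      (q m * (w ^ j) ^ m) * (k n * Cconj (w ^ j) ^ n))%C M) M)) by (intros j; apply Csum_n_prod).
    rewrite sum_n_switch, <- Csum_n_mult_l. apply sum_n_ext_loc. intros m Hm.
    rewrite sum_n_switch.
    assert (Ei : forall n, sum_n (fun j => (q m * (w ^ j) ^ m) * (k n * Cconj (w ^ j) ^ n))%C N
      = ((q m * k n) * sum_n (fun j => (w ^ j) ^ m * Cconj (w ^ j) ^ n)%C N)%C :> C).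
    { intros n. rewrite <- Csum_n_mult_l. apply sum_n_ext. intros j. Cring. }
    rewrite (Csum_n_single _ m) by
      (try assumption; intros n Hn Hnm; rewrite Ei, (roots_orthogonal_conj M) by auto; Cring).
    rewrite Ei. rewrite (sum_n_ext _ (fun _ => RtoC 1)), Csum_n_one; [Cring|].
    intros j. rewrite <- Cpow_mult_l. unfold w. rewrite Ccis_pow, Ccis_conj_r. apply Cpow_1_l. }
  assert (E2 : sum_n (fun j => P (w ^ j) * Cconj (Q (w ^ j)))%C N
    = (RtoC (INR (S N)) * (q 0%nat * Cconj (k 0%nat)))%C :> C).
  { rewrite (sum_n_ext _ (fun j => sum_n (fun m => sum_n (fun n =>
      (q m * (w ^ j) ^ m) * (Cconj (k n) * (w ^ j) ^ n))%C M) M)).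
    2:{ intros j. unfold Q. rewrite Cconj_sum_n.
        rewrite (sum_n_ext _ (fun n => Cconj (k n) * (w ^ j) ^ n)%C); [apply Csum_n_prod|].
        intros n. rewrite Cmult_conj, Cpow_conj. now rewrite Cconj_conj. }
    rewrite sum_n_switch.
    assert (Ei : forall m n, sum_n (fun j => (q m * (w ^ j) ^ m) * (Cconj (k n) * (w ^ j) ^ n))%C N
      = ((q m * Cconj (k n)) * sum_n (fun j => (w ^ j) ^ m * (w ^ j) ^ n)%C N)%C :> C).
    { intros m n. rewrite <- Csum_n_mult_l. apply sum_n_ext. intros j. Cring. }
    rewrite (Csum_n_single _ 0%nat).
    - rewrite sum_n_switch. rewrite (Csum_n_single _ 0%nat).
      + rewrite Ei. rewrite (sum_n_ext _ (fun _ => RtoC 1)), Csum_n_one; [Cring|].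
        intros j. simpl. Cring.
      + lia.
      + intros n Hn Hn0. rewrite Ei, (roots_orthogonal_mult M) by lia. Cring.
    - lia.
    - intros m Hm Hm0. rewrite sum_n_switch. apply Csum_n_zero. intros n Hn.
      rewrite Ei, (roots_orthogonal_mult M) by lia. Cring. }
  assert (Hpos : 0 <= sum_n (fun j => Re (P (w ^ j)%C * Q (w ^ j)%C) + Re (P (w ^ j)%C * Cconj (Q (w ^ j)%C))) N).
  { apply sum_n_nonneg. intros j.
    assert (H1 : Cmod (w ^ j) = 1) by (rewrite Cmod_pow; unfold w; rewrite Cmod_Ccis; apply pow1).
    specialize (HP _ H1). specialize (HQ _ H1). fold (P (w ^ j)%C) in HP. fold (Q (w ^ j)%C) in HQ.
    replace (Re (P (w ^ j)%C * Q (w ^ j)%C) + Re (P (w ^ j)%C * Cconj (Q (w ^ j)%C)))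
      with (2 * (Re (P (w ^ j)%C) * Re (Q (w ^ j)%C))).
    - generalize (Rmult_le_pos _ _ HP HQ). lra.
    - destruct (P (w ^ j)%C), (Q (w ^ j)%C). simpl. ring. }
  rewrite (sum_n_plus (G := R_AbelianMonoid)), <- !re_sum_n, E1, E2, !re_scal_l in Hpos.
  apply Rmult_le_reg_l with (INR (S N)); [assumption|]. rewrite Rmult_0_r.
  rewrite Rmult_plus_distr_l. exact Hpos.
Qed.

Lemma Csum_n_add_constant (q f : nat -> C) (t : C) (M : nat) :
  sum_n (fun n => match n with 0%nat => q 0%nat + t | _ => q n end * f n)%C M
    = (sum_n (fun n => q n * f n)%C M + t * f 0%nat)%C :> C.
Proof. induction M as [|M IH]; [rewrite !sum_O|rewrite !Csum_n_S, IH]; Cring. Qed.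

(* A truncation of [q] has real part at least minus the tail on the unit circle, so adding
   the tail to the constant coefficient makes [positive_pairing] applicable. *)
Lemma positive_pairing_tail (q : nat -> C) (M : nat) :
  Cabs_summable q ->
  (forall x, Cmod x = 1 -> 0 <= Re (Csum (fun n => q n * x ^ n)%C)) ->
  forall k : nat -> C,
  (forall x, Cmod x = 1 -> 0 <= Re (sum_n (fun n => k n * Cconj x ^ n)%C M)) ->
  0 <= Re (sum_n (fun n => q n * k n)%C M) + Re (q 0%nat * Cconj (k 0%nat))
     + 2 * Re (k 0%nat) * Series (fun n => Cmod (q (S M + n)%nat)).
Proof.
  intros Hq HP k Hk. set (tau := Series _).
  set (q' := fun n => match n with 0%nat => (q 0%nat + RtoC tau)%C | _ => q n end).
  assert (E : forall f : nat -> C, sum_n (fun n => q' n * f n)%C M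
    = (sum_n (fun n => q n * f n)%C M + RtoC tau * f 0%nat)%C :> C).
  { intros f. apply Csum_n_add_constant. }
  assert (H := positive_pairing M q' k). rewrite E in H.
  replace (Re (sum_n (fun n => q n * k n)%C M) + Re (q 0%nat * Cconj (k 0%nat)) + 2 * Re (k 0%nat) * tau)
    with (Re (sum_n (fun n => q n * k n)%C M + RtoC tau * k 0%nat) + Re (q' 0%nat * Cconj (k 0%nat))).
  2:{ rewrite re_plus. unfold q'. generalize (Re (sum_n (fun n => q n * k n)%C M)). intros s.
      destruct (q 0%nat), (k 0%nat). simpl. ring. }
  apply H; [|assumption]. clear H. intros x Hx. rewrite E, re_plus.
  specialize (HP x Hx).
  assert (Hs : Cabs_summable (fun n => q n * x ^ n)%C).
  { apply Cabs_summable_le with (2 := Hq). intros n. rewrite Cmod_mult, Cmod_pow, Hx, pow1. lra. }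
  change (0 <= Series (fun n => Re (q n * x ^ n))) in HP.
  rewrite (Series_incr_n _ (S M)) in HP; [|lia|now apply Cabs_summable_re].
  rewrite re_sum_n, sum_n_Reals. simpl Init.Nat.pred in HP.
  replace (Re (RtoC tau * x ^ 0)) with tau by (simpl; ring).
  assert (Ht : Series (fun j => Re (q (S M + j)%nat * x ^ (S M + j))) <= tau).
  { apply Rle_trans with (1 := Rle_abs _).
    assert (Hq' : ex_series (fun n => Cmod (q (S M + n)%nat))) by exact (proj1 (ex_series_incr_n _ (S M)) Hq).
    assert (Hle : forall n, Rabs (Re (q (S M + n)%nat * x ^ (S M + n))) <= Cmod (q (S M + n)%nat)).
    { intros n. apply Rle_trans with (1 := re_le_Cmod _). rewrite Cmod_mult, Cmod_pow, Hx, pow1. lra. }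
    apply Rle_trans with (1 := Series_Rabs _ (ex_series_le (V := R_CompleteNormedModule)
      (fun n => Rabs (Re (q (S M + n)%nat * x ^ (S M + n)))) _
      (fun n => Rle_trans _ _ _ (Req_le _ _ (Rabs_Rabsolu _)) (Hle n)) Hq')).
    apply Series_le; [|assumption]. intros n. split; [apply Rabs_pos|apply Hle]. }
  lra.
Qed.

Lemma Series_tail_lim (u : nat -> R) : ex_series u ->
  is_lim_seq (fun M => Series (fun n => u (S M + n)%nat)) 0.
Proof.
  intros Hu.
  apply is_lim_seq_ext with (fun M => Series u - sum_n u M).
  - intros M. rewrite (Series_incr_n u (S M)) by (lia || assumption).
    rewrite sum_n_Reals. simpl. ring.
  - replace (Finite 0) with (Rbar_minus (Series u) (Series u)) by (simpl; f_equal; ring).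
    apply is_lim_seq_minus'; [apply is_lim_seq_const|]. exact (Series_correct u Hu).
Qed.

Lemma is_lim_seq_ge_0 (u : nat -> R) (l : R) (N : nat) :
  is_lim_seq u l -> (forall n, (N <= n)%nat -> 0 <= u n) -> 0 <= l.
Proof.
  intros Hl H. apply (is_lim_seq_le_loc (fun _ => 0) u 0 l); [|apply is_lim_seq_const|assumption].
  exists N. exact H.
Qed.

(** The test kernel is [1 - u x^(-(n + 1))], where [u] rotates [q (S n)] to its modulus; its real
    part is nonnegative because [|u| = 1]. The pairing gives [1 - |q (S n)| + 1] plus a multiple of
    the tail, and the tail vanishes as [M] grows. *)
Lemma caratheodory_summable (q : nat -> C) (n : nat) :
  Cabs_summable q -> q 0%nat = RtoC 1 ->
  (forall x, Cmod x = 1 -> 0 <= Re (Csum (fun n => q n * x ^ n)%C)) ->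
  Cmod (q (S n)) <= 2.
Proof.
  intros Hq Hq0 HP. destruct (exists_unit_rotation (q (S n))) as [u [Hu Eu]].
  set (k := fun m => if Nat.eqb m 0 then RtoC 1 else if Nat.eqb m (S n) then (- u)%C else RtoC 0).
  assert (Es : forall M (f : nat -> C), (S n <= M)%nat ->
    sum_n (fun m => k m * f m)%C M = (f 0%nat - u * f (S n))%C :> C).
  { intros M f HM.
    transitivity (sum_n (fun m => (if Nat.eqb m 0 then f 0%nat else 0)
      + (if Nat.eqb m (S n) then - u * f (S n) else 0))%C M).
    - apply sum_n_ext. intros m. unfold k.
      destruct (Nat.eqb_spec m 0) as [->|H0]; [cbn [Nat.eqb]; Cring|].
      destruct (Nat.eqb_spec m (S n)) as [->|H1]; Cring.
    - transitivity ((sum_n (fun m => if Nat.eqb m 0 then f 0%nat else RtoC 0) M : C)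
        + (sum_n (fun m => if Nat.eqb m (S n) then - u * f (S n) else RtoC 0)%C M : C))%C.
      { exact (sum_n_plus (G := C_AbelianMonoid) _ _ M). }
      rewrite (Csum_n_single _ 0%nat), (Csum_n_single _ (S n)).
      + rewrite !Nat.eqb_refl. Cring.
      + assumption.
      + intros j _ Hj. now destruct (Nat.eqb_spec j (S n)).
      + lia.
      + intros j _ Hj. now destruct (Nat.eqb_spec j 0). }
  assert (H : forall M, (S n <= M)%nat ->
    0 <= 2 - Cmod (q (S n)) + 2 * Series (fun j => Cmod (q (S M + j)%nat))).
  { intros M HM. generalize (positive_pairing_tail q M Hq HP k).
    rewrite (sum_n_ext (fun n0 => q n0 * k n0)%C (fun n0 => k n0 * q n0)%C) by (intros; Cring).
    rewrite Es, Eu, Hq0 by assumption. intros H.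
    match type of H with _ -> 0 <= ?x => replace x with
      (2 - Cmod (q (S n)) + 2 * Series (fun j => Cmod (q (S M + j)%nat))) in H end.
    - apply H. intros x Hx. rewrite Es by assumption.
      unfold Cminus. rewrite re_plus.
      generalize (re_ge (- (u * Cconj x ^ S n))).
      rewrite Cmod_opp, Cmod_mult, Cmod_pow, Cmod_conj, Hx, Hu, pow1. simpl. lra.
    - simpl. ring. }
  assert (Hl : 0 <= 2 - Cmod (q (S n))); [|lra].
  assert (Hlim : is_lim_seq (fun M => 2 - Cmod (q (S n)) + 2 * Series (fun j => Cmod (q (S M + j)%nat)))
    (2 - Cmod (q (S n)) + 2 * 0)).
  { apply is_lim_seq_plus'; [apply is_lim_seq_const|].
    apply (is_lim_seq_scal_l _ 2 0). exact (Series_tail_lim (fun j => Cmod (q j)) Hq). }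
  rewrite Rmult_0_r, Rplus_0_r in Hlim. exact (is_lim_seq_ge_0 _ _ _ Hlim H).
Qed.

(** On [|y| = r] the real part of [1 / (1 - y)] is least at [y = - r]; the subtracted quotient
    bounds the remainder of the geometric series. *)
Lemma poisson_partial_sum (y : C) (r : R) (M : nat) : Cmod y = r -> r < 1 ->
  / (1 + r) - r ^ S M / (1 - r) <= Re (sum_n (fun n => y ^ n)%C M).
Proof.
  intros Hy Hr. assert (Hr0 : 0 <= r) by (rewrite <- Hy; apply Cmod_ge_0).
  assert (Hy1 : 1 - r <= Cmod (1 - y)).
  { generalize (Cmod_triangle (1 - y) y). replace (1 - y + y)%C with (RtoC 1) by ring.
    rewrite Cmod_1. lra. }
  assert (Hn : (1 - y)%C <> 0%C) by (intros E; rewrite E, Cmod_0 in Hy1; lra).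
  replace (sum_n (fun n => y ^ n)%C M) with (/ (1 - y) - y ^ S M / (1 - y))%C.
  2:{ generalize (Cgeom_sum y M). intros E.
      transitivity (- ((y - 1) * sum_n (fun j => y ^ j)%C M) / (1 - y))%C.
      - rewrite E. now field.
      - match goal with |- ?a = ?b => change (@eq C a b) end. now field. }
  unfold Cminus at 1. rewrite re_plus.
  apply Rplus_le_compat.
  - set (a := Re y).
    assert (Ha : Rabs a <= r) by (rewrite <- Hy; apply re_le_Cmod). apply Rabs_le_between in Ha.
    assert (E : Cmod (1 - y) ^ 2 = 1 - 2 * a + r ^ 2).
    { rewrite <- Hy, 2!Cmod2_alt. unfold a, Re, Im. simpl. ring. }
    assert (Hp : 0 < Cmod (1 - y) ^ 2) by (apply pow_lt; lra).
    replace (Re (/ (1 - y))) with ((1 - a) / Cmod (1 - y) ^ 2).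
    2:{ rewrite Cmod2_alt. unfold a, Re, Im. simpl. reflexivity. }
    rewrite E in *. apply Rmult_le_reg_r with (1 - 2 * a + r ^ 2); [assumption|].
    apply Rmult_le_reg_l with (1 + r); [lra|].
    field_simplify; [|lra|lra]. nra.
  - apply Rle_trans with (2 := re_ge _). rewrite Cmod_opp, Cmod_div, Cmod_pow, Hy by assumption.
    apply Ropp_le_contravar. apply Rmult_le_compat_l; [apply pow_le; assumption|].
    apply Rinv_le_contravar; lra.
Qed.

(** The Poisson kernel [2 Re(1 / (1 - y)) - 1] has minimum [(1 - r) / (1 + r)]; subtracting it
    leaves the constant [- 2 / (1 + r)]. The shift [t M] is this constant plus the truncation error
    from [poisson_partial_sum], which keeps the truncated kernel nonnegative. In the limit the
    pairing reads [2 Re p(z) + 2 - 4 / (1 + r) >= 0]. *)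
Lemma harnack_summable (q : nat -> C) (z : C) :
  Cabs_summable q -> q 0%nat = RtoC 1 -> inD z ->
  (forall x, Cmod x = 1 -> 0 <= Re (Csum (fun n => q n * x ^ n)%C)) ->
  (1 - Cmod z) / (1 + Cmod z) <= Re (CPS q z).
Proof.
  intros Hq Hq0 Hz HP. set (r := Cmod z). assert (Hr : r < 1) by exact Hz.
  assert (Hr0 : 0 <= r) by apply Cmod_ge_0.
  set (t := fun M => - (2 / (1 + r)) + 2 * (r ^ S M / (1 - r))).
  assert (Hs : Cabs_summable (fun n => q n * z ^ n)%C).
  { apply Cabs_summable_le with (2 := Hq). intros n. rewrite Cmod_mult, Cmod_pow.
    fold r. assert (r ^ n <= 1) by (rewrite <- (pow1 n); apply pow_incr; lra).
    generalize (Cmod_ge_0 (q n)). nra. }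
  assert (H : forall M, 0 <= 2 * sum_n (fun n => Re (q n * z ^ n)) M + t M + (2 + t M)
     + 2 * (2 + t M) * Series (fun n => Cmod (q (S M + n)%nat))).
  { intros M.
    set (k := fun n => match n with 0%nat => (2 * z ^ 0 + RtoC (t M))%C | _ => (2 * z ^ n)%C end).
    assert (E : forall f : nat -> C, sum_n (fun n => k n * f n)%C M
      = (sum_n (fun n => 2 * z ^ n * f n)%C M + RtoC (t M) * f 0%nat)%C :> C)
      by (intros f; apply (Csum_n_add_constant (fun n => 2 * z ^ n)%C)).
    assert (Hk : forall x, Cmod x = 1 -> 0 <= Re (sum_n (fun n => k n * Cconj x ^ n)%C M)).
    { intros x Hx. rewrite E.
      rewrite (sum_n_ext _ (fun n => 2 * (z * Cconj x) ^ n)%C) by (intros n; rewrite Cpow_mult_l; Cring).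
      rewrite Csum_n_mult_l, re_plus, re_scal_l.
      generalize (poisson_partial_sum (z * Cconj x)%C r M). intros Hpp.
      assert (Hm : Cmod (z * Cconj x) = r) by (rewrite Cmod_mult, Cmod_conj, Hx; fold r; ring).
      specialize (Hpp Hm Hr).
      replace (Re (RtoC (t M) * Cconj x ^ 0)) with (t M) by (simpl; ring).
      change (fun n => ((z * Cconj x) ^ n)%C) with (Cpow (z * Cconj x)) in Hpp. unfold t; unfold Rdiv in Hpp |- *. lra. }
    generalize (positive_pairing_tail q M Hq HP k Hk).
    rewrite (sum_n_ext (fun n0 => q n0 * k n0)%C (fun n0 => k n0 * q n0)%C) by (intros; Cring).
    rewrite E.
    rewrite (sum_n_ext _ (fun n => 2 * (q n * z ^ n))%C) by (intros; Cring).
    rewrite Csum_n_mult_l, re_plus, re_scal_l, Hq0, re_sum_n.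
    replace (Re (RtoC (t M) * 1)) with (t M) by (simpl; ring).
    replace (Re (1 * Cconj (k 0%nat))) with (2 + t M) by (unfold k; simpl; ring).
    replace (Re (k 0%nat)) with (2 + t M) by (unfold k; simpl; ring). tauto. }
  assert (Ht : is_lim_seq t (- (2 / (1 + r)) + 2 * (0 / (1 - r)))).
  { apply is_lim_seq_plus'; [apply is_lim_seq_const|].
    apply (is_lim_seq_scal_l _ 2 (0 / (1 - r))).
    apply (is_lim_seq_scal_r _ (/ (1 - r)) 0).
    apply (is_lim_seq_incr_1 (fun n => r ^ n)). apply is_lim_seq_geom. rewrite Rabs_pos_eq; lra. }
  unfold Rdiv at 2 in Ht. rewrite Rmult_0_l, Rmult_0_r, Rplus_0_r in Ht.
  assert (Hsum : is_lim_seq (fun M => 2 * sum_n (fun n => Re (q n * z ^ n)) M)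
    (2 * Series (fun n => Re (q n * z ^ n)))).
  { apply (is_lim_seq_scal_l _ 2 (Series (fun n => Re (q n * z ^ n)))).
    exact (Series_correct _ (Cabs_summable_re _ Hs)). }
  assert (Ht2 := is_lim_seq_plus' _ _ _ _ (is_lim_seq_const 2) Ht).
  assert (Hlim := is_lim_seq_plus' _ _ _ _
    (is_lim_seq_plus' _ _ _ _ (is_lim_seq_plus' _ _ _ _ Hsum Ht) Ht2)
    (is_lim_seq_mult' _ _ _ _ (is_lim_seq_mult' _ _ _ _ (is_lim_seq_const 2) Ht2)
      (Series_tail_lim (fun j => Cmod (q j)) Hq))).
  assert (Hfin := is_lim_seq_ge_0 _ _ 0 Hlim (fun M _ => H M)).
  change (Re (CPS q z)) with (Series (fun n => Re (q n * z ^ n))).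
  replace ((1 - r) / (1 + r)) with (2 / (1 + r) - 1) by (field; lra). lra.
Qed.

(** Every passage to the boundary goes through this form: dilations with [rho] tending to 1, and
    partial sums evaluated at radius 1. *)
Lemma le_at_1 (f : R -> R) (s a : R) : s < 1 -> continuity_pt f 1 ->
  (forall x, s < x < 1 -> f x <= a) -> f 1 <= a.
Proof.
  intros Hs Hf H. apply Rnot_lt_le. intros Hlt.
  destruct (Hf (f 1 - a)) as [d [Hd Hx]]; [lra|].
  set (x := Rmax ((s + 1) / 2) (1 - d / 2)).
  assert (Hx1 : s < x < 1).
  { unfold x, Rmax. destruct (Rle_dec ((s + 1) / 2) (1 - d / 2)); lra. }
  assert (Hx2 : 1 - d / 2 <= x) by apply Rmax_r.
  specialize (H x Hx1).
  assert (Hd2 : Rabs (f x - f 1) < f 1 - a).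
  { apply Hx. split; [split; [exact I|lra]|]. simpl. unfold R_dist.
    rewrite Rabs_left; lra. }
  apply Rabs_lt_between in Hd2. lra.
Qed.

(** A dilation makes the series absolutely summable on the closed disk, as the pairing on the unit
    circle demands; the parameter then tends to 1. *)
Lemma Cabs_summable_dilate (q : nat -> C) (rho : R) : disk_summable q -> 0 <= rho < 1 ->
  Cabs_summable (fun n => q n * RtoC rho ^ n)%C.
Proof.
  intros Hq Hr. apply (CPS_summable q (RtoC rho) Hq).
  unfold inD. rewrite Cmod_R, Rabs_pos_eq; lra.
Qed.

Lemma Csum_dilate (q : nat -> C) (rho : R) (x : C) :
  Csum (fun n => q n * RtoC rho ^ n * x ^ n)%C = CPS q (RtoC rho * x)%C.
Proof. apply Csum_ext. intros n. rewrite Cpow_mult_l. ring. Qed.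

Lemma caratheodory (q : nat -> C) (n : nat) :
  disk_summable q -> q 0%nat = RtoC 1 -> (forall z, inD z -> 0 <= Re (CPS q z)) ->
  Cmod (q (S n)) <= 2.
Proof.
  intros Hq Hq0 HP.
  replace (Cmod (q (S n))) with (Cmod (q (S n)) * 1 ^ S n) by (rewrite pow1; ring).
  apply (le_at_1 (fun x => Cmod (q (S n)) * x ^ S n) 0 2); [lra|reg|].
  intros rho Hr.
  replace (Cmod (q (S n)) * rho ^ S n) with (Cmod (q (S n) * RtoC rho ^ S n))
    by (rewrite Cmod_mult, Cmod_pow, Cmod_R, Rabs_pos_eq; lra).
  apply (caratheodory_summable (fun n => q n * RtoC rho ^ n)%C).
  - apply Cabs_summable_dilate; [assumption|lra].
  - rewrite Hq0. simpl. ring.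
  - intros x Hx. rewrite Csum_dilate. apply HP. unfold inD.
    rewrite Cmod_mult, Cmod_R, Hx, Rabs_pos_eq; lra.
Qed.

Lemma harnack (q : nat -> C) (z : C) :
  disk_summable q -> q 0%nat = RtoC 1 -> (forall z, inD z -> 0 <= Re (CPS q z)) -> inD z ->
  (1 - Cmod z) / (1 + Cmod z) <= Re (CPS q z).
Proof.
  intros Hq Hq0 HP Hz. set (r := Cmod z). assert (Hr0 : 0 <= r) by apply Cmod_ge_0.
  assert (Hr1 : r < 1) by exact Hz.
  replace ((1 - r) / (1 + r)) with ((fun x => (x - r) / (Rabs x + r)) 1) by (rewrite Rabs_R1; reflexivity).
  apply (le_at_1 (fun x => (x - r) / (Rabs x + r)) r); [assumption| |].
  - apply continuity_pt_div; [reg| |rewrite Rabs_R1; lra].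
    apply continuity_pt_plus; [apply Rcontinuity_abs|reg].
  - intros rho Hr. rewrite (Rabs_pos_eq rho) by lra.
    assert (Hrc : RtoC rho <> 0) by (intros E; injection E; lra).
    assert (Hm : Cmod (z / RtoC rho) = r / rho)
      by (rewrite Cmod_div, Cmod_R, Rabs_pos_eq by (lra || assumption); reflexivity).
    assert (Hd : inD (z / RtoC rho)%C).
    { unfold inD. rewrite Hm. apply Rmult_lt_reg_r with rho; [lra|]. field_simplify; lra. }
    generalize (harnack_summable (fun n => q n * RtoC rho ^ n)%C (z / RtoC rho)%C).
    unfold CPS at 1. rewrite Csum_dilate.
    replace (RtoC rho * (z / RtoC rho))%C with z by now field.
    rewrite Hm. replace ((1 - r / rho) / (1 + r / rho)) with ((rho - r) / (rho + r)) by (field; lra).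
    intros H. apply H.
    + apply Cabs_summable_dilate; [assumption|lra].
    + rewrite Hq0. simpl. ring.
    + assumption.
    + intros x Hx. rewrite Csum_dilate. apply HP. unfold inD.
      rewrite Cmod_mult, Cmod_R, Hx, Rabs_pos_eq; lra.
Qed.

(** * The operator F' + alpha z F'' and the extremal function *)

Lemma derive_nonpos_at_left_min (D : R -> R) (t l : R) : 0 < t -> is_derive D t l ->
  (forall x, 0 <= x <= t -> D t <= D x) -> l <= 0.
Proof.
  intros Ht Hd Hm. apply Rnot_lt_le. intros Hl.
  apply is_derive_Reals in Hd. destruct (Hd l Hl) as [d Hx].
  set (h := - Rmin (d / 2) t).
  assert (Hd0 : 0 < d) by apply cond_pos.
  assert (Hh : h < 0 /\ - h <= t /\ - h <= d / 2).
  { unfold h. rewrite Ropp_involutive. repeat split; [|apply Rmin_r|apply Rmin_l].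
    assert (0 < Rmin (d / 2) t) by (apply Rmin_glb_lt; lra). lra. }
  assert (Hq : Rabs ((D (t + h) - D t) / h - l) < l).
  { apply Hx; [lra|]. rewrite Rabs_left; lra. }
  apply Rabs_lt_between in Hq.
  assert (Hp : 0 <= (D (t + h) - D t)) by (generalize (Hm (t + h) ltac:(lra)); lra).
  assert (Hneg : (D (t + h) - D t) / h <= 0).
  { unfold Rdiv. assert (/ h < 0) by (apply Rinv_lt_0_compat; lra). nra. }
  lra.
Qed.

(** If [D] were negative somewhere, its minimum would be at some [t > 0], since [0 <= D 0].
    Minimality on the left gives [D' t <= 0], so [D t + alpha * t * D' t] would be negative. *)
Lemma ode_comparison (alpha s : R) (D D' : R -> R) : 0 <= alpha -> 0 <= s ->
  (forall t, 0 <= t <= s -> is_derive D t (D' t)) ->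
  0 <= D 0 -> (forall t, 0 <= t <= s -> 0 <= D t + alpha * t * D' t) -> 0 <= D s.
Proof.
  intros Ha Hs Hd H0 H. apply Rnot_lt_le. intros Hlt.
  destruct (continuity_ab_min D 0 s Hs) as [t [Hm Ht]].
  { intros c Hc. apply derivable_continuous_pt. exists (D' c). apply is_derive_Reals. now apply Hd. }
  assert (Hts := Hm s ltac:(lra)).
  assert (Ht0 : 0 < t) by (destruct (Rle_lt_or_eq_dec 0 t (proj1 Ht)) as [|<-]; lra).
  assert (Hl : D' t <= 0).
  { apply (derive_nonpos_at_left_min D t); [assumption|now apply Hd|]. intros x Hx. apply Hm. lra. }
  specialize (H t Ht). assert (0 <= alpha * t) by nra. nra.
Qed.

Lemma nonneg_derive_le (G G' : R -> R) (s : R) : 0 <= s ->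
  (forall t, 0 <= t <= s -> is_derive G t (G' t)) ->
  (forall t, 0 <= t <= s -> 0 <= G' t) -> G 0 <= G s.
Proof.
  intros Hs Hd Hp.
  destruct (MVT_gen G 0 s G') as [c [Hc E]].
  - intros x Hx. rewrite Rmin_left, Rmax_right in Hx by assumption. apply Hd. lra.
  - intros x Hx. rewrite Rmin_left, Rmax_right in Hx by assumption.
    apply derivable_continuous_pt. exists (G' x). apply is_derive_Reals. apply Hd. lra.
  - rewrite Rmin_left, Rmax_right in Hc by assumption. generalize (Hp c Hc). nra.
Qed.

Lemma CPS_ext (c d : nat -> C) (z : C) : (forall n, c n = d n) -> CPS c z = CPS d z.
Proof. intros H. apply Csum_ext. intros n. now rewrite H. Qed.

Lemma CPS_plus (c d : nat -> C) (z : C) : disk_summable c -> disk_summable d -> inD z ->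
  CPS (fun n => c n + d n)%C z = (CPS c z + CPS d z)%C.
Proof.
  intros Hc Hd Hz. unfold CPS. rewrite <- Csum_plus by now apply CPS_summable.
  apply Csum_ext. intros n. ring.
Qed.

Lemma CPS_scal (k : C) (c : nat -> C) (z : C) : disk_summable c -> inD z ->
  CPS (fun n => k * c n)%C z = (k * CPS c z)%C.
Proof.
  intros Hc Hz. unfold CPS. rewrite <- Csum_scal by now apply CPS_summable.
  apply Csum_ext. intros n. ring.
Qed.

Lemma is_series_zero : is_series (fun _ : nat => 0) 0.
Proof.
  apply filterlim_ext with (fun _ => 0); [|apply filterlim_const].
  intros n. rewrite sum_n_const. symmetry. apply Rmult_0_r.
Qed.

Lemma Series_zero : Series (fun _ => 0) = 0.
Proof. exact (is_series_unique _ _ is_series_zero). Qed.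

Lemma CPS_0 (c : nat -> C) : CPS c (RtoC 0) = c 0%nat.
Proof.
  unfold CPS. rewrite Csum_incr_1.
  - rewrite (Csum_ext _ (fun _ => RtoC 0)).
    + replace (Csum (fun _ => RtoC 0)) with (RtoC 0); [simpl; ring|].
      unfold Csum. simpl. now rewrite Series_zero.
    + intros n. simpl. ring.
  - apply ex_series_incr_1. apply ex_series_ext with (fun _ => 0).
    + intros n. rewrite Cmod_mult, Cmod_pow, Cmod_0, pow_i by lia. symmetry. apply Rmult_0_r.
    + exists 0. exact is_series_zero.
Qed.

Lemma disk_summable_mul_n (c : nat -> C) : disk_summable c ->
  disk_summable (fun n => RtoC (INR n) * c n)%C.
Proof.
  intros Hc r Hr. apply ex_series_incr_1.
  apply ex_series_ext with (fun n => scal r (Cmod (Cderiv_coef c n) * r ^ n)).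
  - intros n. unfold scal, Cderiv_coef; simpl. unfold mult; simpl. ring.
  - apply (ex_series_scal r (fun n => Cmod (Cderiv_coef c n) * r ^ n)).
    now apply disk_summable_deriv.
Qed.

Lemma CPS_mul_n (c : nat -> C) (z : C) : disk_summable c -> inD z ->
  CPS (fun n => RtoC (INR n) * c n)%C z = (z * CPS (Cderiv_coef c) z)%C.
Proof.
  intros Hc Hz. unfold CPS at 1.
  rewrite Csum_incr_1 by (apply (CPS_summable (fun n => RtoC (INR n) * c n)%C); [now apply disk_summable_mul_n|assumption]).
  unfold CPS. rewrite <- Csum_scal by (apply CPS_summable; [now apply disk_summable_deriv|assumption]).
  change (INR 0) with 0.
  match goal with |- (?x + ?y)%C = _ => replace x with (RtoC 0) by ring end.
  rewrite Cplus_0_l. apply Csum_ext. intros n. unfold Cderiv_coef. rewrite Cpow_S. ring.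
Qed.

Lemma den_S (alpha : R) (n : nat) : den alpha (S n) = INR (S n) * (1 + alpha * INR n).
Proof. unfold den. rewrite S_INR. ring. Qed.

Lemma den_ge (alpha : R) (n : nat) : 0 <= alpha -> INR (S n) <= den alpha (S n).
Proof.
  intros Ha. rewrite den_S. generalize (pos_INR (S n)) (Rmult_le_pos _ _ Ha (pos_INR n)). nra.
Qed.

Lemma den_pos (alpha : R) (n : nat) : 0 <= alpha -> 0 < den alpha (S n).
Proof. intros Ha. generalize (den_ge alpha n Ha) (pos_INR n). rewrite S_INR. lra. Qed.

(* Taylor coefficients of [F' + alpha z F''] when those of [F] are [c]. *)
Definition pcoef (alpha : R) (c : nat -> C) (n : nat) : C := (RtoC (den alpha (S n)) * c (S n))%C.

Lemma pcoef_eq (alpha : R) (c : nat -> C) (n : nat) :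
  pcoef alpha c n = (Cderiv_coef c n + RtoC alpha * (RtoC (INR n) * Cderiv_coef c n))%C.
Proof.
  unfold pcoef, Cderiv_coef. rewrite den_S, RtoC_mult, RtoC_plus, (RtoC_mult alpha). ring.
Qed.

Lemma disk_summable_pcoef (alpha : R) (c : nat -> C) : disk_summable c -> disk_summable (pcoef alpha c).
Proof.
  intros Hc. apply disk_summable_le with (fun n => Cderiv_coef c n + RtoC alpha * (RtoC (INR n) * Cderiv_coef c n))%C.
  - intros n. rewrite pcoef_eq. lra.
  - apply disk_summable_plus; [|apply disk_summable_scal, disk_summable_mul_n]; now apply disk_summable_deriv.
Qed.

Lemma CPS_pcoef (alpha : R) (c : nat -> C) (z : C) : disk_summable c -> inD z ->
  CPS (pcoef alpha c) z = (CPS (Cderiv_coef c) z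
    + RtoC alpha * (z * CPS (Cderiv_coef (Cderiv_coef c)) z))%C.
Proof.
  intros Hc Hz. assert (Hd := disk_summable_deriv c Hc).
  rewrite (CPS_ext _ _ z (pcoef_eq alpha c)).
  rewrite (CPS_plus (Cderiv_coef c) (fun n => RtoC alpha * (RtoC (INR n) * Cderiv_coef c n))%C)
    by (try assumption; now apply disk_summable_scal, disk_summable_mul_n).
  rewrite (CPS_scal (RtoC alpha) (fun n => RtoC (INR n) * Cderiv_coef c n)%C)
    by (try assumption; now apply disk_summable_mul_n).
  now rewrite CPS_mul_n.
Qed.

(** * The extremal function and the Cayley transform *)

Definition ext_coef (alpha : R) : nat -> C := hcoef (a_ext alpha).

Lemma disk_summable_ext (alpha : R) : 0 <= alpha -> disk_summable (ext_coef alpha).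
Proof.
  intros Ha. apply disk_summable_bounded. intros r Hr. exists 2. intros n.
  assert (Hp : 0 <= r ^ n <= 1).
  { split; [apply pow_le; lra|]. rewrite <- (pow1 n). apply pow_incr. lra. }
  assert (Cmod (ext_coef alpha n) <= 2).
  { destruct n as [|[|n]]; simpl.
    - rewrite Cmod_0. lra.
    - rewrite Cmod_1. lra.
    - unfold a_ext. rewrite Cmod_R.
      assert (Hd := den_ge alpha (S n) Ha). rewrite S_INR in Hd. assert (H0 := pos_INR (S n)).
      rewrite Rabs_pos_eq by (apply Rdiv_le_0_compat; lra).
      apply Rmult_le_reg_r with (den alpha (S (S n))); [lra|].
      replace (2 / den alpha (S (S n)) * den alpha (S (S n))) with 2 by (field; lra). nra. }
  generalize (Cmod_ge_0 (ext_coef alpha n)). nra.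
Qed.

Lemma pcoef_ext (alpha : R) (n : nat) : 0 <= alpha ->
  pcoef alpha (ext_coef alpha) n = match n with 0%nat => RtoC 1 | _ => RtoC 2 end.
Proof.
  intros Ha. unfold pcoef. destruct n as [|n].
  - rewrite den_S. simpl. rewrite !Rmult_0_r, Rplus_0_r, !Rmult_1_r. ring.
  - simpl ext_coef. unfold a_ext. rewrite <- RtoC_mult. f_equal. field.
    generalize (den_pos alpha (S n) Ha). lra.
Qed.

Lemma disk_summable_one : disk_summable (fun _ => RtoC 1).
Proof.
  apply disk_summable_bounded. intros r Hr. exists 1. intros n. rewrite Cmod_1.
  assert (r ^ n <= 1) by (rewrite <- (pow1 n); apply pow_incr; lra). lra.
Qed.

Lemma CPS_one (z : C) : inD z -> CPS (fun _ => RtoC 1) z = (/ (1 - z))%C.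
Proof.
  intros Hz.
  assert (Hn : (1 - z)%C <> 0%C).
  { intros E. assert (E' : z = RtoC 1) by (replace z with (RtoC 1 - (1 - z))%C by ring; rewrite E; ring).
    unfold inD in Hz. rewrite E', Cmod_1 in Hz. lra. }
  assert (Hs := disk_summable_one).
  assert (E : CPS (fun _ => RtoC 1) z = (1 + z * CPS (fun _ => RtoC 1) z)%C).
  { unfold CPS. rewrite Csum_incr_1 at 1 by (apply (CPS_summable (fun _ => RtoC 1)); assumption).
    rewrite <- Csum_scal by (apply (CPS_summable (fun _ => RtoC 1)); assumption).
    f_equal; [simpl; ring|]. apply Csum_ext. intros n. rewrite Cpow_S. ring. }
  set (s := CPS _ z) in *.
  transitivity ((s - z * s) / (1 - z))%C; [now field|].
  rewrite E at 1. now field.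
Qed.

(** The right-hand side is [(1 + z) / (1 - z)], with Taylor coefficients 1, 2, 2, ..., the extremal
    function for both the Caratheodory and the Harnack bounds. *)
Lemma CPS_pcoef_ext (alpha : R) (z : C) : 0 <= alpha -> inD z ->
  CPS (pcoef alpha (ext_coef alpha)) z = (2 * / (1 - z) - 1)%C.
Proof.
  intros Ha Hz. rewrite <- CPS_one by assumption.
  assert (Hs := disk_summable_one).
  unfold CPS. rewrite Csum_incr_1, (Csum_incr_1 (fun n => RtoC 1 * z ^ n)%C).
  - rewrite pcoef_ext by assumption. rewrite Cmult_plus_distr_l, <- Csum_scal.
    + rewrite (Csum_ext (fun n => pcoef alpha (ext_coef alpha) (S n) * z ^ S n)%C
        (fun n => 2 * (1 * z ^ S n))%C).
      * generalize (Csum (fun n => 2 * (1 * z ^ S n))%C). intros x. simpl. ring.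
      * intros n. rewrite pcoef_ext by assumption. ring.
    + apply (proj1 (ex_series_incr_1 _)) with (1 := CPS_summable (fun _ => RtoC 1) z Hs Hz).
  - now apply (CPS_summable (fun _ => RtoC 1)).
  - apply (CPS_summable (pcoef alpha (ext_coef alpha))); [|assumption].
    now apply disk_summable_pcoef, disk_summable_ext.
Qed.

Lemma re_cayley_pos (z : C) : inD z -> 0 < Re (2 * / (1 - z) - 1).
Proof.
  intros Hz. unfold inD in Hz.
  assert (Hm : Cmod z ^ 2 < 1) by (generalize (Cmod_ge_0 z); simpl; nra).
  rewrite Cmod2_alt in Hm. destruct z as [x y]. unfold Re, Im in Hm. simpl in Hm.
  assert (Hx : x < 1) by nra.
  unfold Re. simpl.
  match goal with |- 0 < ?g => replace g with ((1 - (x * x + y * y)) / ((1 - x) ^ 2 + y ^ 2)) end.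
  - apply Rdiv_lt_0_compat; nra.
  - field. nra.
Qed.

(** * Growth and coefficient bounds *)

(** Points of a ray are written [0 + RtoC t * e] to match [is_derive_line] with base point 0. *)
Lemma Cmod_ray (e : C) (t : R) : Cmod e = 1 -> 0 <= t -> Cmod (0 + RtoC t * e) = t.
Proof. intros He Ht. rewrite Cplus_0_l, Cmod_mult, Cmod_R, He, Rabs_pos_eq; lra. Qed.

Lemma inD_ray (e : C) (t : R) : Cmod e = 1 -> 0 <= t < 1 -> inD (0 + RtoC t * e)%C.
Proof. intros He Ht. unfold inD. rewrite Cmod_ray; lra. Qed.

Lemma Cmod_neg_one : Cmod (RtoC (-1)) = 1.
Proof. rewrite Cmod_R, Rabs_left; lra. Qed.

Lemma polar (z : C) : exists e : C, Cmod e = 1 /\ z = (0 + RtoC (Cmod z) * e)%C.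
Proof.
  destruct (exists_unit_rotation z) as [u [Hu E]]. exists (Cconj u).
  split; [now rewrite Cmod_conj|]. rewrite <- E.
  transitivity ((u * Cconj u) * z)%C; [|ring].
  rewrite <- Cmod2_conj, Hu, pow1. ring.
Qed.

(** Equality in Harnack's inequality holds on the negative radius, which is why [psi] and [growth]
    are taken along the direction -1. *)
Lemma cayley_neg (t : R) : 0 <= t -> Re (2 * / (1 - (0 + RtoC t * RtoC (-1))) - 1) = (1 - t) / (1 + t).
Proof.
  intros Ht. replace (1 - (0 + RtoC t * RtoC (-1)))%C with (RtoC (1 + t))
    by (rewrite RtoC_plus; replace (RtoC (-1)) with (- (1))%C by (apply C_eq; simpl; ring); ring).
  rewrite <- RtoC_inv by lra. rewrite <- RtoC_mult, <- RtoC_minus. simpl. field. lra.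
Qed.

(* If [p = F' + alpha z F''] has nonnegative real part and [p 0 = 1], then [t |-> Re F' (t e)]
   is a supersolution of the equation [y + alpha t y' = (1 - t) / (1 + t)]. *)
Lemma re_deriv_ge_subsolution (alpha : R) (c : nat -> C) (e : C) (s : R) (B B' : R -> R) :
  0 <= alpha -> disk_summable c -> c 1%nat = RtoC 1 ->
  (forall z, inD z -> 0 <= Re (CPS (pcoef alpha c) z)) ->
  Cmod e = 1 -> 0 <= s < 1 ->
  (forall t, 0 <= t <= s -> is_derive B t (B' t)) -> B 0 <= 1 ->
  (forall t, 0 <= t <= s -> B t + alpha * t * B' t <= (1 - t) / (1 + t)) ->
  B s <= Re (CPS (Cderiv_coef c) (0 + RtoC s * e)%C).
Proof.
  intros Ha Hc Hc1 HP He Hs HB HB0 HBs.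
  assert (Hd1 := disk_summable_deriv c Hc). assert (Hd2 := disk_summable_deriv _ Hd1).
  set (D := fun t => Re (1 * CPS (Cderiv_coef c) (0 + RtoC t * e)%C) - B t).
  set (D' := fun t => Re (1 * (e * CPS (Cderiv_coef (Cderiv_coef c)) (0 + RtoC t * e)%C)) - B' t).
  assert (H : 0 <= D s).
  { apply (ode_comparison alpha s D D' Ha (proj1 Hs)).
    - intros t Ht.
      apply @is_derive_minus; [|now apply HB].
      apply is_derive_line. apply is_derive_CPS; [assumption|]. apply inD_ray; [assumption|lra].
    - unfold D. replace (0 + RtoC 0 * e)%C with (RtoC 0) by ring.
      rewrite CPS_0. unfold Cderiv_coef. rewrite Hc1. simpl. lra.
    - intros t Ht. specialize (HBs t Ht).
      assert (Hin : inD (0 + RtoC t * e)%C) by (apply inD_ray; [assumption|lra]).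
      assert (Hh : (1 - t) / (1 + t) <= Re (CPS (pcoef alpha c) (0 + RtoC t * e)%C)).
      { rewrite <- (Cmod_ray e t) at 1 2 by (assumption || lra).
        apply harnack; try assumption.
        - now apply disk_summable_pcoef.
        - unfold pcoef. rewrite Hc1, den_S. simpl. rewrite Rmult_0_r, Rplus_0_r, Rmult_1_r. ring. }
      rewrite CPS_pcoef in Hh by assumption.
      unfold D, D'. revert Hh HBs.
      replace (Re (CPS (Cderiv_coef c) (0 + RtoC t * e)%C + RtoC alpha * ((0 + RtoC t * e)
        * CPS (Cderiv_coef (Cderiv_coef c)) (0 + RtoC t * e)%C)))
      with (Re (1 * CPS (Cderiv_coef c) (0 + RtoC t * e)%C)
        + alpha * t * Re (1 * (e * CPS (Cderiv_coef (Cderiv_coef c)) (0 + RtoC t * e)%C))).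
      2:{ destruct (CPS (Cderiv_coef c) _), (CPS (Cderiv_coef (Cderiv_coef c)) _), e. simpl. ring. }
      lra. }
  unfold D in H. rewrite Cmult_1_l in H. lra.
Qed.

(** The solution of [y + alpha t y' = (1 - t) / (1 + t)] with value 1 at 0. Given by the series of
    the extremal function, it is differentiable at once and is defined for [alpha = 0] too. *)
Definition psi (alpha t : R) : R := Re (CPS (Cderiv_coef (ext_coef alpha)) (0 + RtoC t * RtoC (-1))%C).

Lemma is_derive_psi (alpha t : R) : 0 <= alpha -> 0 <= t < 1 ->
  exists l, is_derive (psi alpha) t l /\ psi alpha t + alpha * t * l = (1 - t) / (1 + t).
Proof.
  intros Ha Ht. assert (Hc := disk_summable_ext alpha Ha).
  assert (Hd1 := disk_summable_deriv _ Hc).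
  assert (Hin := inD_ray (RtoC (-1)) t Cmod_neg_one Ht).
  exists (Re (1 * (RtoC (-1) * CPS (Cderiv_coef (Cderiv_coef (ext_coef alpha))) (0 + RtoC t * RtoC (-1))%C))).
  split.
  - apply is_derive_ext with (fun s => Re (1 * CPS (Cderiv_coef (ext_coef alpha)) (0 + RtoC s * RtoC (-1))%C)).
    + intros s. now rewrite Cmult_1_l.
    + apply is_derive_line. now apply is_derive_CPS.
  - rewrite <- cayley_neg, <- (CPS_pcoef_ext alpha), CPS_pcoef by (assumption || lra).
    unfold psi.
    destruct (CPS (Cderiv_coef (ext_coef alpha)) _), (CPS (Cderiv_coef (Cderiv_coef (ext_coef alpha))) _).
    simpl. ring.
Qed.

Lemma psi_0 (alpha : R) : psi alpha 0 = 1.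
Proof.
  unfold psi. replace (0 + RtoC 0 * RtoC (-1))%C with (RtoC 0) by ring.
  rewrite CPS_0. unfold Cderiv_coef. simpl. ring.
Qed.

Lemma re_deriv_ge (alpha : R) (c : nat -> C) (z : C) :
  0 <= alpha -> disk_summable c -> c 1%nat = RtoC 1 ->
  (forall z, inD z -> 0 <= Re (CPS (pcoef alpha c) z)) -> inD z ->
  psi alpha (Cmod z) <= Re (CPS (Cderiv_coef c) z) /\ 0 < Re (CPS (Cderiv_coef c) z).
Proof.
  intros Ha Hc Hc1 HP Hz. destruct (polar z) as [e [He E]].
  set (s := Cmod z) in *. assert (Hs : 0 <= s < 1) by (split; [apply Cmod_ge_0|exact Hz]).
  rewrite E. split.
  - apply (re_deriv_ge_subsolution alpha c e s (psi alpha) (Derive (psi alpha))); try assumption.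
    + intros t Ht. destruct (is_derive_psi alpha t Ha ltac:(lra)) as [l [Hl _]].
      now rewrite (is_derive_unique _ _ _ Hl).
    + rewrite psi_0. lra.
    + intros t Ht. destruct (is_derive_psi alpha t Ha ltac:(lra)) as [l [Hl El]].
      rewrite (is_derive_unique _ _ _ Hl). lra.
  (* Harnack's bound decreases in [t], so its value at the endpoint [s] is a constant subsolution on
     [[0, s]]. This gives positivity directly; that of [psi] itself then follows by taking the
     extremal function for [c]. *)
  - apply Rlt_le_trans with ((1 - s) / (1 + s)); [apply Rdiv_lt_0_compat; lra|].
    apply (re_deriv_ge_subsolution alpha c e s (fun _ => (1 - s) / (1 + s)) (fun _ => 0)); try assumption.
    + intros t Ht. apply @is_derive_const.
    + apply Rmult_le_reg_r with (1 + s); [lra|]. field_simplify; lra.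
    + intros t Ht. rewrite Rmult_0_r, Rplus_0_r.
      apply Rmult_le_reg_r with (1 + s); [lra|]. apply Rmult_le_reg_r with (1 + t); [lra|].
      field_simplify; [|lra|lra]. nra.
Qed.

(** The derivatives quantified in [in_W0H] are determined by the power series, so the class can be
    described by coefficient sequences alone. *)
Definition W0H_coef (alpha : R) (A B : nat -> C) : Prop :=
  A 0%nat = RtoC 0 /\ A 1%nat = RtoC 1 /\ B 0%nat = RtoC 0 /\ B 1%nat = RtoC 0 /\
  disk_summable A /\ disk_summable B /\
  forall z, inD z -> Cmod (CPS (pcoef alpha B) z) < Re (CPS (pcoef alpha A) z).

(** Uniqueness of the complex derivative is taken from real derivatives along a line, with weights 1
    and [- Ci]. Agreement on the disk is enough because the disk is open. *)
Lemma is_derive_CPS_eq (c : nat -> C) (f f1 : C -> C) (z : C) : disk_summable c -> inD z ->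
  (forall y, inD y -> f y = CPS c y) -> is_derive (K := C_AbsRing) f z (f1 z) ->
  f1 z = CPS (Cderiv_coef c) z.
Proof.
  intros Hc Hz Hf Hd.
  assert (Hd' : is_derive (K := C_AbsRing) (CPS c) z (f1 z)).
  { apply is_derive_ext_loc with (2 := Hd).
    assert (Hp : 0 < 1 - Cmod z) by (unfold inD in Hz; lra).
    exists (mkposreal _ Hp). intros y Hy. apply Hf.
    assert (Hy' : Cmod (y - z) < 1 - Cmod z) by exact Hy.
    unfold inD. generalize (Cmod_triangle z (y - z)).
    assert (Ey : forall y : C, (z + (y - z))%C = y) by (intros; ring). rewrite Ey. lra. }
  assert (Hl : forall w, Re (w * f1 z) = Re (w * CPS (Cderiv_coef c) z)).
  { intros w.
    assert (E0 : (z + RtoC 0 * 1)%C = z) by ring.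
    assert (H1 := is_derive_line (CPS c) z 1 (f1 z) w 0). rewrite E0 in H1. specialize (H1 Hd').
    assert (H2 := is_derive_line (CPS c) z 1 (CPS (Cderiv_coef c) z) w 0). rewrite E0 in H2.
    specialize (H2 (is_derive_CPS c z Hc Hz)).
    rewrite !Cmult_1_l in H1, H2.
    now rewrite <- (is_derive_unique _ _ _ H1), <- (is_derive_unique _ _ _ H2). }
  apply C_eq.
  - generalize (Hl (RtoC 1)). now rewrite !Cmult_1_l.
  - generalize (Hl (- Ci)%C). destruct (f1 z), (CPS (Cderiv_coef c) z). simpl. lra.
Qed.

Lemma in_W0H_coef (alpha : R) (a b : nat -> C) : in_W0H alpha a b ->
  W0H_coef alpha (hcoef a) (gcoef b).
Proof.
  intros [H0 [h1 [h2 [g1 [g2 [Hd HW]]]]]].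
  assert (HA : disk_summable (hcoef a)) by (apply disk_summable_of_series; intros z Hz; apply (H0 z Hz)).
  assert (HB : disk_summable (gcoef b)) by (apply disk_summable_of_series; intros z Hz; apply (H0 z Hz)).
  repeat split; try assumption. intros z Hz.
  assert (Eh1 : forall y, inD y -> h1 y = CPS (Cderiv_coef (hcoef a)) y).
  { intros y Hy. apply (is_derive_CPS_eq _ (hfun a)); try assumption; [reflexivity|]. apply (Hd y Hy). }
  assert (Eg1 : forall y, inD y -> g1 y = CPS (Cderiv_coef (gcoef b)) y).
  { intros y Hy. apply (is_derive_CPS_eq _ (gfun b)); try assumption; [reflexivity|]. apply (Hd y Hy). }
  assert (Eh2 : h2 z = CPS (Cderiv_coef (Cderiv_coef (hcoef a))) z).
  { apply (is_derive_CPS_eq _ h1); try assumption; [now apply disk_summable_deriv|]. apply (Hd z Hz). }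
  assert (Eg2 : g2 z = CPS (Cderiv_coef (Cderiv_coef (gcoef b))) z).
  { apply (is_derive_CPS_eq _ g1); try assumption; [now apply disk_summable_deriv|]. apply (Hd z Hz). }
  rewrite !CPS_pcoef, <- Eh1, <- Eg1, <- Eh2, <- Eg2 by assumption. now apply HW.
Qed.

Lemma coef_in_W0H (alpha : R) (a b : nat -> C) :
  W0H_coef alpha (hcoef a) (gcoef b) -> in_W0H alpha a b.
Proof.
  intros (_ & _ & _ & _ & HA & HB & HW). 
  assert (Hser : forall c z, disk_summable c -> inD z ->
    exists l, is_series (fun n => Cmult (c n) (pow_n z n)) l).
  { intros c z Hc Hz. apply (ex_series_le (V := C_CompleteNormedModule)) with (2 := CPS_summable c z Hc Hz).
    intros n. apply Rle_refl. }
  split.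
  - intros z Hz. split; now apply Hser.
  - exists (CPS (Cderiv_coef (hcoef a))), (CPS (Cderiv_coef (Cderiv_coef (hcoef a)))),
      (CPS (Cderiv_coef (gcoef b))), (CPS (Cderiv_coef (Cderiv_coef (gcoef b)))).
    split.
    + intros z Hz. assert (HA1 := disk_summable_deriv _ HA). assert (HB1 := disk_summable_deriv _ HB).
      split; [|split; [|split]].
      * now apply (is_derive_CPS (hcoef a)).
      * now apply is_derive_CPS.
      * now apply (is_derive_CPS (gcoef b)).
      * now apply is_derive_CPS.
    + intros z Hz. rewrite <- !CPS_pcoef by assumption. now apply HW.
Qed.

Lemma W0H_coef_slice (alpha : R) (A B : nat -> C) (eps : C) : W0H_coef alpha A B -> Cmod eps = 1 ->
  let c := fun n => (A n + eps * B n)%C in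
  disk_summable c /\ c 1%nat = RtoC 1 /\ forall z, inD z -> 0 <= Re (CPS (pcoef alpha c) z).
Proof.
  intros (_ & HA1 & _ & HB1 & HA & HB & HW) He c. repeat split.
  - apply disk_summable_plus; [assumption|]. now apply disk_summable_scal.
  - unfold c. rewrite HA1, HB1. ring.
  - intros z Hz. specialize (HW z Hz).
    rewrite (CPS_ext _ (fun n => pcoef alpha A n + eps * pcoef alpha B n)%C) by (intros n; unfold pcoef, c; ring).
    assert (HpA := disk_summable_pcoef alpha A HA). assert (HpB := disk_summable_pcoef alpha B HB).
    rewrite (CPS_plus (pcoef alpha A) (fun n => eps * pcoef alpha B n)%C) by (try assumption; now apply disk_summable_scal).
    rewrite CPS_scal by assumption. rewrite re_plus.
    generalize (re_ge (eps * CPS (pcoef alpha B) z)). rewrite Cmod_mult, He. lra.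
Qed.

(** The slice depends on the point: if [u] rotates [g'(z)] to its modulus, then [h - u g] has
    derivative of real part [Re h'(z) - |g'(z)|] at [z]. *)
Lemma W0H_deriv_bound (alpha : R) (A B : nat -> C) (z : C) : 0 <= alpha -> W0H_coef alpha A B -> inD z ->
  psi alpha (Cmod z) <= Re (CPS (Cderiv_coef A) z) - Cmod (CPS (Cderiv_coef B) z) /\
  0 < Re (CPS (Cderiv_coef A) z) - Cmod (CPS (Cderiv_coef B) z).
Proof.
  intros Ha HW Hz. destruct (exists_unit_rotation (CPS (Cderiv_coef B) z)) as [u [Hu E]].
  destruct (W0H_coef_slice alpha A B (- u)%C HW) as (Hc & Hc1 & HP); [now rewrite Cmod_opp|].
  destruct HW as (_ & _ & _ & _ & HA & HB & _).
  generalize (re_deriv_ge alpha _ z Ha Hc Hc1 HP Hz).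
  replace (Re (CPS (Cderiv_coef (fun n => A n + - u * B n)%C) z))
    with (Re (CPS (Cderiv_coef A) z) - Cmod (CPS (Cderiv_coef B) z)); [tauto|].
  rewrite (CPS_ext (Cderiv_coef (fun n => A n + - u * B n)%C)
    (fun n => Cderiv_coef A n + (- u) * Cderiv_coef B n)%C) by (intros n; unfold Cderiv_coef; ring).
  rewrite (CPS_plus (Cderiv_coef A) (fun n => - u * Cderiv_coef B n)%C)
    by (try apply disk_summable_scal; try apply disk_summable_deriv; assumption).
  rewrite CPS_scal by (try apply disk_summable_deriv; assumption).
  replace (- u * CPS (Cderiv_coef B) z)%C with (- (u * CPS (Cderiv_coef B) z))%C by ring.
  rewrite E, re_plus. simpl. ring.
Qed.

Lemma W0H_coef_bound (alpha : R) (A B : nat -> C) (n : nat) : 0 <= alpha -> W0H_coef alpha A B ->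
  Cmod (A (S (S n))) + Cmod (B (S (S n))) <= 2 / den alpha (S (S n)).
Proof.
  intros Ha HW.
  destruct (exists_unit_rotation (A (S (S n)))) as [u [Hu Eu]].
  destruct (exists_unit_rotation (B (S (S n)))) as [v [Hv Ev]].
  (* This [eps] gives the two coefficients the same argument, so the modulus of the slice
     coefficient is the sum of the moduli. *)
  set (eps := (Cconj u * v)%C).
  assert (He : Cmod eps = 1) by (unfold eps; rewrite Cmod_mult, Cmod_conj, Hu, Hv; ring).
  destruct (W0H_coef_slice alpha A B eps HW He) as (Hc & Hc1 & HP).
  assert (Hq := caratheodory _ n (disk_summable_pcoef alpha _ Hc)).
  unfold pcoef at 1 3 in Hq. rewrite Hc1, den_S in Hq.
  specialize (Hq ltac:(simpl; rewrite Rmult_0_r, Rplus_0_r, Rmult_1_r; ring) HP).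
  assert (Hd := den_pos alpha (S n) Ha).
  rewrite Cmod_mult, Cmod_R, (Rabs_pos_eq (den _ _)) in Hq by lra.
  replace (Cmod (A (S (S n)) + eps * B (S (S n)))) with (Cmod (A (S (S n))) + Cmod (B (S (S n)))) in Hq.
  - apply Rmult_le_reg_l with (den alpha (S (S n))); [assumption|].
    apply Rle_trans with (1 := Hq). right. field. lra.
  - transitivity (Cmod (u * (A (S (S n)) + eps * B (S (S n))))).
    + replace (u * (A (S (S n)) + eps * B (S (S n))))%C
        with (u * A (S (S n)) + (u * Cconj u) * (v * B (S (S n))))%C by (unfold eps; ring).
      rewrite <- Cmod2_conj, Hu, pow1, Eu, Ev, Cmult_1_l, <- RtoC_plus, Cmod_R.
      rewrite Rabs_pos_eq; [reflexivity|]. apply Rplus_le_le_0_compat; apply Cmod_ge_0.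
    + rewrite Cmod_mult, Hu. ring.
Qed.

(** The sign makes it increase from 0, with derivative [psi]. The lower bound [W0H_growth] is
    attained by the extremal function at [- t]. *)
Definition growth (alpha t : R) : R := - Re (CPS (ext_coef alpha) (0 + RtoC t * RtoC (-1))%C).

Lemma growth_0 (alpha : R) : growth alpha 0 = 0.
Proof.
  unfold growth. replace (0 + RtoC 0 * RtoC (-1))%C with (RtoC 0) by ring.
  rewrite CPS_0. simpl. ring.
Qed.

Lemma is_derive_growth (alpha t : R) : 0 <= alpha -> 0 <= t < 1 ->
  is_derive (growth alpha) t (psi alpha t).
Proof.
  intros Ha Ht.
  apply is_derive_ext with (fun s => Re (RtoC (-1) * CPS (ext_coef alpha) (0 + RtoC s * RtoC (-1))%C)).
  - intros s. unfold growth. rewrite re_scal_l. match goal with |- ?a = ?b => change (@eq R a b) end; ring.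
  - replace (psi alpha t) with
      (Re (RtoC (-1) * (RtoC (-1) * CPS (Cderiv_coef (ext_coef alpha)) (0 + RtoC t * RtoC (-1))%C))).
    + apply is_derive_line. apply is_derive_CPS; [now apply disk_summable_ext|].
      apply inD_ray; [apply Cmod_neg_one|assumption].
    + unfold psi. rewrite !re_scal_l. ring.
Qed.

(** The modulus is bounded below by the component of [f] along the ray. Conjugating [g] turns the
    weight [Cconj e] into [e], so this component has derivative [Re h' + Re(e^2 g')], at least
    [Re h' - |g'|]. *)
Lemma W0H_growth (alpha : R) (A B : nat -> C) (z : C) : 0 <= alpha -> W0H_coef alpha A B -> inD z ->
  growth alpha (Cmod z) <= Cmod (CPS A z + Cconj (CPS B z))%C.
Proof.
  intros Ha HW Hz. destruct (polar z) as [e [He E]].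
  set (s := Cmod z) in *. assert (Hs : 0 <= s < 1) by (split; [apply Cmod_ge_0|exact Hz]).
  assert (HW' := HW). destruct HW' as (HA0 & _ & HB0 & _ & HA & HB & _).
  set (G := fun t => Re (Cconj e * CPS A (0 + RtoC t * e)%C) + Re (e * CPS B (0 + RtoC t * e)%C) - growth alpha t).
  set (G' := fun t => Re (Cconj e * (e * CPS (Cderiv_coef A) (0 + RtoC t * e)%C))
    + Re (e * (e * CPS (Cderiv_coef B) (0 + RtoC t * e)%C)) - psi alpha t).
  assert (H : G 0 <= G s).
  { apply (nonneg_derive_le G G' s (proj1 Hs)).
    - intros t Ht. assert (Hin : inD (0 + RtoC t * e)%C) by (apply inD_ray; [assumption|lra]).
      apply @is_derive_minus; [apply @is_derive_plus|].
      + apply is_derive_line. now apply is_derive_CPS.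
      + apply is_derive_line. now apply is_derive_CPS.
      + apply is_derive_growth; [assumption|lra].
    - intros t Ht. assert (Hin : inD (0 + RtoC t * e)%C) by (apply inD_ray; [assumption|lra]).
      generalize (proj1 (W0H_deriv_bound alpha A B _ Ha HW Hin)).
      rewrite Cmod_ray by (assumption || lra). unfold G'.
      rewrite !Cmult_assoc, (Cmult_comm (Cconj e)), <- Cmod2_conj, He, pow1, Cmult_1_l.
      generalize (re_ge (e * e * CPS (Cderiv_coef B) (0 + RtoC t * e)%C)).
      rewrite !Cmod_mult, He. lra. }
  unfold G in H. rewrite growth_0 in H.
  replace (0 + RtoC 0 * e)%C with (RtoC 0) in H by ring.
  rewrite !CPS_0, HA0, HB0, !Cmult_0_r, <- E in H.
  apply Rle_trans with (Re (Cconj e * (CPS A z + Cconj (CPS B z)))).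
  - replace (Re (Cconj e * (CPS A z + Cconj (CPS B z)))) with (Re (Cconj e * CPS A z) + Re (e * CPS B z)).
    + change (Re (RtoC 0)) with 0 in H. lra.
    + destruct e, (CPS A z), (CPS B z). simpl. ring.
  - apply Rle_trans with (1 := re_le _). rewrite Cmod_mult, Cmod_conj, He. lra.
Qed.

(** * The image contains a disk *)

(** A lower semicontinuous function attains its infimum, here [- l]. Otherwise every point has a
    neighbourhood where [G] exceeds [- l] by a positive amount, and compactness makes that amount
    uniform. *)
Lemma disc_min (G : C -> R) (r : R) : 0 <= r -> (forall z, 0 <= G z) ->
  (forall z, Cmod z <= r -> forall eps, 0 < eps -> exists d, 0 < d /\
     forall y, Cmod y <= r -> Cmod (y - z) < d -> G z - eps < G y) ->
  exists z0, Cmod z0 <= r /\ forall z, Cmod z <= r -> G z0 <= G z.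
Proof.
  intros Hr Hpos HG.
  destruct (completeness (fun x => exists z, Cmod z <= r /\ x = - G z)) as [l [Hub Hlub]].
  { exists 0. intros x [z [_ ->]]. generalize (Hpos z). lra. }
  { exists (- G 0%C), 0%C. split; [rewrite Cmod_0; assumption|reflexivity]. }
  apply NNPP. intros Hno.
  assert (Hgt : forall z, Cmod z <= r -> - l < G z).
  { intros z Hz. apply Rnot_le_lt. intros Hle. apply Hno. exists z. split; [assumption|].
    intros y Hy. generalize (Hub (- G y) (ex_intro _ y (conj Hy eq_refl))). lra. }
  (* The compactness result concerns a square, so the gauge is also needed off the disk; there it is
     small enough for the neighbourhood to miss the disk. Inside, [G z - (G z + l) / 2 = - l + (G z
     + l) / 2], hence [G > - l + d] nearby. *)
  assert (Hch : forall z : C, exists d : posreal,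
    (Cmod z <= r -> d <= (G z + l) / 2 /\
       forall y, Cmod y <= r -> Cmod (y - z) < 2 * d -> G z - (G z + l) / 2 < G y) /\
    (r < Cmod z -> 2 * d <= Cmod z - r)).
  { intros z. destruct (Rle_lt_dec (Cmod z) r) as [Hz|Hz].
    - assert (Hp := Hgt z Hz).
      destruct (HG z Hz ((G z + l) / 2) ltac:(lra)) as [d [Hd Hy]].
      assert (Hm : 0 < Rmin ((G z + l) / 2) (d / 2)) by (apply Rmin_glb_lt; lra).
      exists (mkposreal _ Hm). simpl. split; [|lra]. intros _. split; [apply Rmin_l|].
      intros y Hyr Hyd. apply Hy; [assumption|].
      generalize (Rmin_r ((G z + l) / 2) (d / 2)). lra.
    - assert (Hm : 0 < (Cmod z - r) / 2) by lra.
      exists (mkposreal _ Hm). simpl. split; lra. }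
  set (delta := fun u v : R => proj1_sig (constructive_indefinite_description _ (Hch (u, v)))).
  assert (Hdelta := fun u v : R => proj2_sig (constructive_indefinite_description _ (Hch (u, v)))).
  destruct (compactness_value_2d (- r) r (- r) r delta) as [d Hd].
  assert (Hlow : forall z, Cmod z <= r -> - l + d <= G z).
  { intros z Hz.
    assert (Hz1 : Rabs (Re z) <= r) by (apply Rle_trans with (1 := re_le_Cmod z); assumption).
    assert (Hz2 : Rabs (Im z) <= r) by (apply Rle_trans with (1 := im_le_Cmod z); assumption).
    apply Rabs_le_between in Hz1. apply Rabs_le_between in Hz2.
    destruct (NNPP _ (Hd (Re z) (Im z) Hz1 Hz2)) as (u & v & _ & _ & Hu & Hv & Hdd).
    destruct (Hdelta u v) as [H1 H2]. fold (delta u v) in H1, H2.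
    (* A square of half side [delta] lies in the disk of radius [sqrt 2 * delta]; this is the reason
       for the factor 2 in [Hch]. *)
    assert (Hdist : Cmod (z - (u, v)) < 2 * delta u v).
    { apply Rle_lt_trans with (1 := Cmod_2Rmax _).
      assert (Hmax : Rmax (Rabs (fst (z - (u, v))%C)) (Rabs (snd (z - (u, v))%C)) < delta u v)
        by (apply Rmax_lub_lt; assumption).
      assert (Hs : sqrt 2 <= 2).
      { rewrite <- (sqrt_square 2) at 2 by lra. apply sqrt_le_1; lra. }
      assert (0 <= Rmax (Rabs (fst (z - (u, v))%C)) (Rabs (snd (z - (u, v))%C)))
        by (apply Rle_trans with (2 := Rmax_l _ _); apply Rabs_pos).
      generalize (cond_pos (delta u v)) (sqrt_pos 2). nra. }
    destruct (Rle_lt_dec (Cmod (u, v)) r) as [Huv|Huv].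
    - destruct (H1 Huv) as [H3 H4]. specialize (H4 z Hz Hdist). lra.
    - specialize (H2 Huv). generalize (Cmod_triangle z ((u, v) - z)).
      set (y := ((u, v) : C)) in *.
      replace (z + (y - z))%C with y by Cring.
      replace (y - z)%C with (- (z - y))%C by ring. rewrite Cmod_opp. lra. }
  assert (Hc : l <= l - d).
  { apply Hlub. intros x [z [Hz ->]]. generalize (Hlow z Hz). lra. }
  generalize (cond_pos d). lra.
Qed.

Lemma CPS_continuous (c : nat -> C) (z : C) : disk_summable c -> inD z ->
  forall eps, 0 < eps -> exists d, 0 < d /\
    forall y, Cmod (y - z) < d -> Cmod (CPS c y - CPS c z) < eps.
Proof.
  intros Hc Hz eps Heps.
  destruct (is_derive_C_eps _ _ _ (is_derive_CPS c z Hc Hz) (mkposreal 1 Rlt_0_1)) as [d Hd].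
  set (l := CPS (Cderiv_coef c) z) in Hd.
  assert (Hl : 0 < Cmod l + 1) by (generalize (Cmod_ge_0 l); lra).
  exists (Rmin d (eps / (Cmod l + 1))). split.
  { apply Rmin_glb_lt; [apply cond_pos|]. now apply Rdiv_lt_0_compat. }
  intros y Hy. set (k := (y - z)%C) in *.
  specialize (Hd k (Rlt_le_trans _ _ _ Hy (Rmin_l _ _))). simpl in Hd.
  replace (z + k)%C with y in Hd by (unfold k; ring).
  assert (Hk : Cmod k * (Cmod l + 1) < eps).
  { apply Rmult_lt_reg_r with (/ (Cmod l + 1)); [now apply Rinv_0_lt_compat|].
    rewrite Rmult_assoc, Rinv_r, Rmult_1_r by lra.
    exact (Rlt_le_trans _ _ _ Hy (Rmin_r _ _)). }
  replace (CPS c y - CPS c z)%C with ((CPS c y - CPS c z - k * l) + k * l)%C by ring.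
  apply Rle_lt_trans with (1 := Cmod_triangle _ _). rewrite Cmod_mult. lra.
Qed.

Lemma neg_derive_decrease (N : R -> R) (l d : R) : is_derive N 0 l -> l < 0 -> 0 < d ->
  exists t, 0 < t < d /\ N t < N 0.
Proof.
  intros Hd Hl Hdd. apply is_derive_Reals in Hd. destruct (Hd (- l)) as [e He]; [lra|].
  set (t := Rmin (d / 2) (e / 2)). assert (He0 := cond_pos e).
  assert (Ht : 0 < t /\ t <= d / 2 /\ t <= e / 2)
    by (repeat split; [apply Rmin_glb_lt; lra|apply Rmin_l|apply Rmin_r]).
  exists t. split; [lra|].
  specialize (He t ltac:(lra) ltac:(rewrite Rabs_pos_eq; lra)). rewrite Rplus_0_l in He.
  apply Rabs_lt_between in He.
  assert (Hq : (N t - N 0) / t < 0) by lra.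
  assert (N t - N 0 = (N t - N 0) / t * t) by (field; lra). nra.
Qed.

(* Since [Re h' > |g'|], moving from [z] in direction [w - f z] decreases [|f - w|]. *)
Lemma W0H_descent (alpha : R) (A B : nat -> C) (z w : C) (d : R) :
  0 <= alpha -> W0H_coef alpha A B -> inD z -> 0 < d ->
  (CPS A z + Cconj (CPS B z))%C <> w ->
  exists y, Cmod (y - z) < d /\
    Cmod (CPS A y + Cconj (CPS B y) - w) < Cmod (CPS A z + Cconj (CPS B z) - w).
Proof.
  intros Ha HW Hz Hd Hne.
  assert (Hb := proj2 (W0H_deriv_bound alpha A B z Ha HW Hz)).
  destruct HW as (_ & _ & _ & _ & HA & HB & _).
  set (u := (CPS A z + Cconj (CPS B z) - w)%C).
  assert (Hu : 0 < Cmod u).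
  { apply Cmod_gt_0. intros E. apply Hne.
    replace (CPS A z + Cconj (CPS B z))%C with (u + w)%C by (unfold u; ring). rewrite E. ring. }
  (* [X] and [Y] are the real and imaginary parts of [f - w] along the path [z - t u]; conjugation
     of [g] changes [- Ci] into [Ci]. *)
  set (X := fun t => Re (1 * CPS A (z + RtoC t * - u)%C) + Re (1 * CPS B (z + RtoC t * - u)%C) - Re w).
  set (Y := fun t => Re (- Ci * CPS A (z + RtoC t * - u)%C) + Re (Ci * CPS B (z + RtoC t * - u)%C) - Im w).
  set (h := CPS (Cderiv_coef A) z) in *. set (g := CPS (Cderiv_coef B) z) in *.
  assert (E0 : z = (z + RtoC 0 * - u)%C) by ring.
  assert (HdA := is_derive_CPS A z HA Hz). assert (HdB := is_derive_CPS B z HB Hz).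
  fold h in HdA. fold g in HdB. rewrite E0 in HdA, HdB.
  assert (HX : is_derive X 0 (Re (1 * (- u * h)) + Re (1 * (- u * g)) - 0)).
  { apply @is_derive_minus; [|apply @is_derive_const].
    apply @is_derive_plus; now apply is_derive_line. }
  assert (HY : is_derive Y 0 (Re (- Ci * (- u * h)) + Re (Ci * (- u * g)) - 0)).
  { apply @is_derive_minus; [|apply @is_derive_const].
    apply @is_derive_plus; now apply is_derive_line. }
  assert (HXY : forall t, X t ^ 2 + Y t ^ 2
    = Cmod (CPS A (z + RtoC t * - u)%C + Cconj (CPS B (z + RtoC t * - u)%C) - w) ^ 2).
  { intros t. rewrite Cmod2_alt. unfold X, Y.
    destruct (CPS A _), (CPS B _), w. simpl. ring. }
  assert (HN : is_derive (fun t => X t ^ 2 + Y t ^ 2) 0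
    (2 * X 0 * (Re (1 * (- u * h)) + Re (1 * (- u * g)) - 0)
     + 2 * Y 0 * (Re (- Ci * (- u * h)) + Re (Ci * (- u * g)) - 0))).
  { apply @is_derive_plus.
    - replace (2 * X 0 * (Re (1 * (- u * h)) + Re (1 * (- u * g)) - 0))
        with (INR 2 * (Re (1 * (- u * h)) + Re (1 * (- u * g)) - 0) * X 0 ^ 1) by (simpl; ring).
      now apply is_derive_pow.
    - replace (2 * Y 0 * (Re (- Ci * (- u * h)) + Re (Ci * (- u * g)) - 0))
        with (INR 2 * (Re (- Ci * (- u * h)) + Re (Ci * (- u * g)) - 0) * Y 0 ^ 1) by (simpl; ring).
      now apply is_derive_pow. }
  assert (EX : X 0 = Re u /\ Y 0 = Im u).
  { unfold X, Y. rewrite <- E0. unfold u. destruct (CPS A z), (CPS B z), w. simpl. split; ring. }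
  destruct EX as [EX EY].
  destruct (neg_derive_decrease _ _ (d / Cmod u) HN) as [t [Ht Hlt]].
  - rewrite EX, EY.
    (* The derivative of [|f - w|^2] is at most [- 2 |u|^2 (Re h - |g|)]. *)
    match goal with |- ?x < 0 => replace x with (2 * (- (Cmod u ^ 2 * Re h) + Re (- (u * u * g)))) end.
    + assert (H := re_le (- (u * u * g))). rewrite Cmod_opp, !Cmod_mult in H.
      assert (0 < Cmod u ^ 2 * (Re h - Cmod g)) by (apply Rmult_lt_0_compat; [apply pow_lt|]; assumption).
      nra.
    + rewrite Cmod2_alt. destruct u, h, g. simpl. ring.
  - now apply Rdiv_lt_0_compat.
  - exists (z + RtoC t * - u)%C. split.
    + replace (z + RtoC t * - u - z)%C with (- (RtoC t * u))%C by ring.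
      rewrite Cmod_opp, Cmod_mult, Cmod_R, Rabs_pos_eq by lra.
      apply Rmult_lt_reg_r with (/ Cmod u); [now apply Rinv_0_lt_compat|].
      rewrite Rmult_assoc, Rinv_r, Rmult_1_r by lra. apply Ht.
    + rewrite !HXY, <- E0 in Hlt.
      apply Rnot_le_lt. intros Hle. apply (Rlt_not_le _ _ Hlt).
      apply pow_incr. split; [apply Cmod_ge_0|assumption].
Qed.

(** The minimiser [y] satisfies [|f(y)| <= |v| + |f(y) - v| <= |v| + |f(z) - v| < growth alpha r],
    whereas [|f| >= growth alpha r] on the circle; hence [|y| < r], and there is room to descend. *)
Lemma W0H_image_step (alpha : R) (A B : nat -> C) (r : R) (z v : C) :
  0 <= alpha -> W0H_coef alpha A B -> r < 1 -> Cmod z <= r ->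
  Cmod v + Cmod (CPS A z + Cconj (CPS B z) - v) < growth alpha r ->
  exists y, Cmod y <= r /\ (CPS A y + Cconj (CPS B y))%C = v.
Proof.
  intros Ha HW Hr Hz Hv.
  assert (HW' := HW). destruct HW' as (_ & _ & _ & _ & HA & HB & _).
  assert (Hr0 : 0 <= r) by (generalize (Cmod_ge_0 z); lra).
  set (f := fun y => (CPS A y + Cconj (CPS B y))%C).
  destruct (disc_min (fun y => Cmod (f y - v)) r Hr0) as [y [Hy Hmin]].
  { intros y. apply Cmod_ge_0. }
  { intros y Hy eps Heps. assert (HyD : inD y) by (unfold inD; lra).
    destruct (CPS_continuous A y HA HyD (eps / 2)) as [d1 [Hd1 H1]]; [lra|].
    destruct (CPS_continuous B y HB HyD (eps / 2)) as [d2 [Hd2 H2]]; [lra|].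
    exists (Rmin d1 d2). split; [now apply Rmin_glb_lt|]. intros x _ Hx.
    specialize (H1 x (Rlt_le_trans _ _ _ Hx (Rmin_l _ _))).
    specialize (H2 x (Rlt_le_trans _ _ _ Hx (Rmin_r _ _))).
    rewrite <- Cmod_conj in H2.
    assert (H3 := Cmod_triangle (f x - v) (- ((CPS A x - CPS A y) + Cconj (CPS B x - CPS B y)))).
    replace (f x - v + - ((CPS A x - CPS A y) + Cconj (CPS B x - CPS B y)))%C with (f y - v)%C in H3.
    2:{ unfold f. rewrite Cminus_conj. ring. }
    rewrite Cmod_opp in H3.
    generalize (Cmod_triangle (CPS A x - CPS A y) (Cconj (CPS B x - CPS B y))). lra. }
  exists y. split; [assumption|].
  assert (HyD : inD y) by (unfold inD; lra).
  apply NNPP. intros Hne.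
  assert (Hfy : Cmod (f y) < growth alpha r).
  { generalize (Cmod_triangle v (f y - v)) (Hmin z Hz). unfold f in *.
    replace (v + (CPS A y + Cconj (CPS B y) - v))%C with (CPS A y + Cconj (CPS B y))%C by ring. lra. }
  assert (Hlt : Cmod y < r).
  { destruct (Rle_lt_or_eq_dec _ _ Hy) as [|E]; [assumption|].
    generalize (W0H_growth alpha A B y Ha HW HyD). rewrite E. unfold f in Hfy. lra. }
  destruct (W0H_descent alpha A B y v (r - Cmod y) Ha HW HyD ltac:(lra) Hne) as [x [Hx1 Hx2]].
  assert (Hx : Cmod x <= r).
  { generalize (Cmod_triangle y (x - y)). replace (y + (x - y))%C with x by ring. lra. }
  specialize (Hmin x Hx). unfold f in Hmin. lra.
Qed.

Lemma W0H_image (alpha : R) (A B : nat -> C) (r : R) (w : C) :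
  0 <= alpha -> W0H_coef alpha A B -> 0 <= r < 1 -> Cmod w < growth alpha r ->
  exists z, inD z /\ (CPS A z + Cconj (CPS B z))%C = w.
Proof.
  intros Ha HW Hr Hw.
  (* The step length [|w| / (n + 1)] must be less than the gap [growth alpha r - |w|], which is
     available along the whole segment for the same [r]. *)
  destruct (INR_unbounded (Cmod w / (growth alpha r - Cmod w))) as [n Hn].
  assert (HN : 0 < INR (S n)) by (apply lt_0_INR; lia).
  assert (Hstep : Cmod w / INR (S n) < growth alpha r - Cmod w).
  { apply Rmult_lt_reg_r with (INR (S n)); [assumption|].
    replace (Cmod w / INR (S n) * INR (S n)) with (Cmod w) by (field; lra).
    apply Rmult_gt_compat_r with (r := growth alpha r - Cmod w) in Hn; [|lra].
    replace (Cmod w / (growth alpha r - Cmod w) * (growth alpha r - Cmod w)) with (Cmod w) in Hn by (field; lra).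
    rewrite S_INR. lra. }
  assert (H : forall j, (j <= S n)%nat -> exists z, Cmod z <= r /\
    (CPS A z + Cconj (CPS B z))%C = (RtoC (INR j / INR (S n)) * w)%C).
  { induction j as [|j IH]; intros Hj.
    - exists (RtoC 0). rewrite Cmod_0. split; [lra|].
      destruct HW as (HA0 & _ & HB0 & _). rewrite !CPS_0, HA0, HB0.
      unfold Rdiv. simpl INR at 1. rewrite Rmult_0_l. apply C_eq; simpl; ring.
    - destruct (IH ltac:(lia)) as [z [Hz Ez]].
      apply (W0H_image_step alpha A B r z); try assumption; [lra|].
      rewrite Ez.
      replace (RtoC (INR j / INR (S n)) * w - RtoC (INR (S j) / INR (S n)) * w)%C
        with (- (RtoC (1 / INR (S n)) * w))%C.
      2:{ rewrite (S_INR j). replace ((INR j + 1) / INR (S n)) with (INR j / INR (S n) + 1 / INR (S n))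
            by (field; lra). rewrite RtoC_plus. ring. }
      rewrite Cmod_opp, !Cmod_mult, !Cmod_R.
      assert (Hj1 : 0 <= INR (S j) / INR (S n) <= 1).
      { split; [apply Rdiv_le_0_compat; [apply pos_INR|assumption]|].
        apply Rmult_le_reg_r with (INR (S n)); [assumption|].
        replace (INR (S j) / INR (S n) * INR (S n)) with (INR (S j)) by (field; lra).
        rewrite Rmult_1_l. apply le_INR. assumption. }
      assert (Hn1 : 0 <= 1 / INR (S n)) by (apply Rdiv_le_0_compat; lra).
      rewrite 2!Rabs_pos_eq by (assumption || apply Hj1).
      unfold Rdiv in *. generalize (Cmod_ge_0 w). nra. }
  destruct (H (S n) (le_n _)) as [z [Hz Ez]]. exists z. split; [unfold inD; lra|].
  rewrite Ez. replace (INR (S n) / INR (S n)) with 1 by (field; lra). ring.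
Qed.

(** * The Bohr radius *)

Lemma ex_series_ext_coef (alpha x : R) : 0 <= alpha -> Rabs x < 1 ->
  ex_series (fun k => 2 / den alpha (k + 2) * x ^ (k + 2)).
Proof.
  intros Ha Hx.
  assert (Hin : inD (RtoC x)) by (unfold inD; now rewrite Cmod_R).
  assert (H := Cabs_summable_re _ (CPS_summable _ _ (disk_summable_ext alpha Ha) Hin)).
  do 2 apply (proj1 (ex_series_incr_1 _)) in H.
  apply ex_series_ext with (2 := H). intros n.
  replace (n + 2)%nat with (S (S n)) by lia.
  unfold ext_coef, hcoef, a_ext. rewrite <- RtoC_pow, <- RtoC_mult. reflexivity.
Qed.

Lemma CPS_ext_real (alpha x : R) : 0 <= alpha -> Rabs x < 1 ->
  CPS (ext_coef alpha) (RtoC x) = RtoC (x + Series (fun k => 2 / den alpha (k + 2) * x ^ (k + 2))).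
Proof.
  intros Ha Hx.
  assert (Hin : inD (RtoC x)) by (unfold inD; now rewrite Cmod_R).
  assert (Hs := CPS_summable _ _ (disk_summable_ext alpha Ha) Hin).
  unfold CPS. rewrite Csum_incr_1 by assumption.
  apply (proj1 (ex_series_incr_1 _)) in Hs. rewrite Csum_incr_1 by assumption.
  rewrite RtoC_plus.
  replace (ext_coef alpha 0 * RtoC x ^ 0)%C with (RtoC 0) by (simpl; ring).
  replace (ext_coef alpha 1 * RtoC x ^ 1)%C with (RtoC x) by (simpl; ring).
  rewrite Cplus_0_l. f_equal.
  assert (E : forall n, (ext_coef alpha (S (S n)) * RtoC x ^ S (S n))%C
    = RtoC (2 / den alpha (n + 2) * x ^ (n + 2))).
  { intros n. replace (n + 2)%nat with (S (S n)) by lia.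
    unfold ext_coef, hcoef, a_ext. now rewrite <- RtoC_pow, <- RtoC_mult. }
  rewrite (Csum_ext _ _ E). apply C_eq; [reflexivity|exact Series_zero].
Qed.

(* Both sides of the equation defining the radius: [lsum alpha r = rsum alpha]. *)
Definition lsum (alpha r : R) : R := Re (CPS (ext_coef alpha) (0 + RtoC r * RtoC 1)%C).
Definition rsum (alpha : R) : R := 1 + 2 * Series (fun k => (-1) ^ (k + 1) / den alpha (k + 2)).

Lemma lsum_eq (alpha r : R) : 0 <= alpha -> Rabs r < 1 ->
  lsum alpha r = r + Series (fun k => 2 / den alpha (k + 2) * r ^ (k + 2)).
Proof.
  intros Ha Hr. unfold lsum. replace (0 + RtoC r * RtoC 1)%C with (RtoC r) by ring.
  now rewrite CPS_ext_real.
Qed.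

Lemma rf_eq_lsum (alpha r : R) : 0 <= alpha -> Rabs r < 1 ->
  (rf_eq alpha r <-> lsum alpha r = rsum alpha).
Proof.
  intros Ha Hr. unfold rf_eq. fold (rsum alpha). rewrite lsum_eq, <- Series_scal_l by assumption.
  rewrite (Series_ext (fun n => 2 * (r ^ (n + 2) / den alpha (n + 2)))
    (fun k => 2 / den alpha (k + 2) * r ^ (k + 2))) by (intros n; unfold Rdiv; ring).
  reflexivity.
Qed.

Lemma W0H_coef_ext (alpha : R) : 0 <= alpha -> W0H_coef alpha (hcoef (a_ext alpha)) (gcoef b_ext).
Proof.
  intros Ha.
  assert (E : forall n, gcoef b_ext n = RtoC 0) by (intros [|[|n]]; reflexivity).
  repeat split.
  - now apply disk_summable_ext.
  - apply disk_summable_le with (2 := disk_summable_one). intros n. rewrite E, Cmod_0. apply Cmod_ge_0.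
  - intros z Hz. fold (ext_coef alpha). rewrite CPS_pcoef_ext by assumption.
    rewrite (CPS_ext _ (fun n => 0 * RtoC 1)%C) by (intros n; unfold pcoef; rewrite E; ring).
    rewrite (CPS_scal 0 (fun _ => RtoC 1)) by (assumption || apply disk_summable_one).
    rewrite Cmult_0_l, Cmod_0. now apply re_cayley_pos.
Qed.

Lemma ffun_ext (alpha : R) (z : C) : inD z -> ffun (a_ext alpha) b_ext z = CPS (ext_coef alpha) z.
Proof.
  intros Hz. unfold ffun. change (gfun b_ext z) with (CPS (gcoef b_ext) z).
  rewrite (CPS_ext (gcoef b_ext) (fun n => 0 * RtoC 1)%C)
    by (intros [|[|n]]; simpl; unfold b_ext; ring).
  rewrite (CPS_scal 0 (fun _ => RtoC 1)) by (assumption || apply disk_summable_one).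
  change (hfun (a_ext alpha) z) with (CPS (ext_coef alpha) z).
  apply C_eq; simpl; ring.
Qed.

Lemma re_deriv_ext_pos (alpha : R) (z : C) : 0 <= alpha -> inD z ->
  0 < Re (CPS (Cderiv_coef (ext_coef alpha)) z).
Proof.
  intros Ha Hz. apply (re_deriv_ge alpha); try assumption.
  - now apply disk_summable_ext.
  - reflexivity.
  - intros y Hy. rewrite CPS_pcoef_ext by assumption. left. now apply re_cayley_pos.
Qed.

Lemma pos_derive_lt (G G' : R -> R) (a b : R) : a < b ->
  (forall t, a <= t <= b -> is_derive G t (G' t)) ->
  (forall t, a <= t <= b -> 0 < G' t) -> G a < G b.
Proof.
  intros Hs Hd Hp.
  destruct (MVT_gen G a b G') as [c [Hc E]].
  - intros x Hx. rewrite Rmin_left, Rmax_right in Hx by lra. apply Hd. lra.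
  - intros x Hx. rewrite Rmin_left, Rmax_right in Hx by lra.
    apply derivable_continuous_pt. exists (G' x). apply is_derive_Reals. apply Hd. lra.
  - rewrite Rmin_left, Rmax_right in Hc by lra. generalize (Hp c Hc). nra.
Qed.

Lemma is_derive_lsum (alpha r : R) : 0 <= alpha -> 0 <= r < 1 ->
  is_derive (lsum alpha) r (Re (CPS (Cderiv_coef (ext_coef alpha)) (0 + RtoC r * RtoC 1)%C)).
Proof.
  intros Ha Hr.
  apply is_derive_ext with (fun s => Re (1 * CPS (ext_coef alpha) (0 + RtoC s * RtoC 1)%C)).
  - intros s. unfold lsum. now rewrite Cmult_1_l.
  - replace (CPS (Cderiv_coef (ext_coef alpha)) (0 + RtoC r * RtoC 1)%C)
      with (1 * (1 * CPS (Cderiv_coef (ext_coef alpha)) (0 + RtoC r * RtoC 1)%C))%C by ring.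
    apply is_derive_line. apply is_derive_CPS; [now apply disk_summable_ext|].
    apply inD_ray; [apply Cmod_1|assumption].
Qed.

Lemma lsum_lt (alpha r s : R) : 0 <= alpha -> 0 <= r < s -> s < 1 -> lsum alpha r < lsum alpha s.
Proof.
  intros Ha Hr Hs.
  apply (pos_derive_lt (lsum alpha) (fun r => Re (CPS (Cderiv_coef (ext_coef alpha)) (0 + RtoC r * RtoC 1)%C)));
    [lra| |].
  - intros t Ht. apply is_derive_lsum; lra.
  - intros t Ht. apply re_deriv_ext_pos; [assumption|]. apply inD_ray; [apply Cmod_1|lra].
Qed.

Lemma lsum_0 (alpha : R) : lsum alpha 0 = 0.
Proof.
  unfold lsum. replace (0 + RtoC 0 * RtoC 1)%C with (RtoC 0) by ring. now rewrite CPS_0.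
Qed.

Lemma growth_lt (alpha r s : R) : 0 <= alpha -> 0 <= r < s -> s < 1 -> growth alpha r < growth alpha s.
Proof.
  intros Ha Hr Hs. apply (pos_derive_lt (growth alpha) (psi alpha)); [lra| |].
  - intros t Ht. apply is_derive_growth; lra.
  - intros t Ht. apply re_deriv_ext_pos; [assumption|]. apply inD_ray; [apply Cmod_neg_one|lra].
Qed.

(** Moduli of the extremal coefficients, shifted by one so that the alternating series begins with
    [+ r]. Index 0 is the coefficient of [z], which is 1, while [2 / den alpha 1] is 2. *)
Definition altcoef (alpha : R) (n : nat) : R := match n with 0%nat => 1 | _ => 2 / den alpha (S n) end.

Lemma den_lt (alpha : R) (n : nat) : 0 <= alpha -> den alpha (S n) < den alpha (S (S n)).
Proof.
  intros Ha. rewrite !den_S, !S_INR. generalize (pos_INR n). intros Hn.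
  assert (0 <= alpha * INR n) by now apply Rmult_le_pos. nra.
Qed.

Lemma altcoef_pos (alpha : R) (n : nat) : 0 <= alpha -> 0 < altcoef alpha n.
Proof.
  intros Ha. destruct n as [|n]; simpl; [lra|].
  apply Rdiv_lt_0_compat; [lra|now apply den_pos].
Qed.

Lemma altcoef_lt (alpha : R) (n : nat) : 0 <= alpha -> altcoef alpha (S (S n)) < altcoef alpha (S n).
Proof.
  intros Ha. simpl. apply Rmult_lt_compat_l; [lra|].
  apply Rinv_lt_contravar; [|now apply den_lt].
  apply Rmult_lt_0_compat; now apply den_pos.
Qed.

(** Only a weak inequality holds at index 0: for [alpha = 0] the first two values are both 1. *)
Lemma altcoef_decr (alpha : R) (n : nat) : 0 <= alpha -> altcoef alpha (S n) <= altcoef alpha n.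
Proof.
  intros Ha. destruct n as [|n]; [|left; now apply altcoef_lt].
  simpl. assert (H := den_ge alpha 1 Ha). simpl in H.
  apply Rmult_le_reg_r with (den alpha 2); [lra|]. field_simplify; lra.
Qed.

Lemma alternating_decr (alpha r : R) : 0 <= alpha -> 0 <= r <= 1 ->
  Un_decreasing (fun n => altcoef alpha n * r ^ S n).
Proof.
  intros Ha Hr n. assert (H1 := altcoef_decr alpha n Ha). assert (H2 := altcoef_pos alpha (S n) Ha).
  assert (H3 : 0 <= r ^ S n) by (apply pow_le; lra).
  change (r ^ S (S n)) with (r * r ^ S n).
  apply Rle_trans with (altcoef alpha (S n) * r ^ S n); [|now apply Rmult_le_compat_r].
  apply Rmult_le_compat_l; [lra|]. nra.
Qed.

Lemma alternating_cv_0 (alpha r : R) : 0 <= alpha -> 0 <= r <= 1 ->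
  Un_cv (fun n => altcoef alpha n * r ^ S n) 0.
Proof.
  intros Ha Hr. apply is_lim_seq_Reals.
  apply (is_lim_seq_incr_1 (fun n => altcoef alpha n * r ^ S n)).
  apply (is_lim_seq_le_le (fun _ => 0) _ (fun n => 2 * / INR (S n)));
    [|apply is_lim_seq_const|].
  - intros n. assert (H2 := altcoef_pos alpha (S n) Ha).
    assert (H3 : 0 <= r ^ S (S n) <= 1).
    { split; [apply pow_le; lra|]. rewrite <- (pow1 (S (S n))). apply pow_incr. lra. }
    split; [apply Rmult_le_pos; lra|].
    apply Rle_trans with (altcoef alpha (S n)); [nra|]. simpl altcoef.
    apply Rmult_le_compat_l; [lra|]. apply Rinv_le_contravar; [apply lt_0_INR; lia|].
    apply Rle_trans with (2 := den_ge alpha (S n) Ha). apply le_INR. lia.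
  - replace (Finite 0) with (Rbar_mult 2 0) by (simpl; f_equal; ring).
    apply is_lim_seq_scal_l.
    apply (is_lim_seq_incr_1 (fun n => / INR n)).
    replace (Finite 0) with (Rbar_inv p_infty) by reflexivity.
    apply is_lim_seq_inv; [apply is_lim_seq_INR|discriminate].
Qed.

(** For [alpha = 0] this is a conditionally convergent alternating harmonic series, so Leibniz's
    criterion provides the convergence. *)
Lemma alternating_cv (alpha : R) : 0 <= alpha ->
  Un_cv (fun N => sum_f_R0 (tg_alt (fun n => altcoef alpha n * 1 ^ S n)) N) (rsum alpha).
Proof.
  intros Ha.
  destruct (alternated_series _ (alternating_decr alpha 1 Ha ltac:(lra)) (alternating_cv_0 alpha 1 Ha ltac:(lra)))
    as [l Hl].
  assert (Hs : is_series (tg_alt (fun n => altcoef alpha n * 1 ^ S n)) l) by (apply is_series_Reals; exact Hl).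
  replace (rsum alpha) with l; [exact Hl|].
  rewrite <- (is_series_unique _ _ Hs), Series_incr_1 by (now exists l).
  unfold rsum. rewrite <- Series_scal_l. f_equal.
  - unfold tg_alt. simpl. ring.
  - apply Series_ext. intros n. unfold tg_alt. rewrite pow1, Rmult_1_r.
    replace (n + 2)%nat with (S (S n)) by lia. replace (n + 1)%nat with (S n) by lia.
    unfold altcoef, Rdiv. ring.
Qed.

Lemma growth_cv (alpha r : R) : 0 <= alpha -> 0 <= r < 1 ->
  Un_cv (fun N => sum_f_R0 (tg_alt (fun n => altcoef alpha n * r ^ S n)) N) (growth alpha r).
Proof.
  intros Ha Hr. apply is_series_Reals.
  assert (Hr' : Rabs (- r) < 1) by (rewrite Rabs_Ropp, Rabs_pos_eq; lra).
  assert (Hex := ex_series_ext_coef alpha (- r) Ha Hr').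
  unfold growth. replace (0 + RtoC r * RtoC (-1))%C with (RtoC (- r))
    by (apply C_eq; simpl; ring).
  rewrite CPS_ext_real by assumption. change (Re (RtoC ?x)) with x.
  assert (E : forall n, 2 / den alpha (n + 2) * (- r) ^ (n + 2)
    = - tg_alt (fun n => altcoef alpha n * r ^ S n) (S n)).
  { intros n. unfold tg_alt. replace (n + 2)%nat with (S (S n)) by lia.
    replace (- r) with (-1 * r) by ring. rewrite Rpow_mult_distr.
    unfold altcoef. simpl. ring. }
  apply (is_series_decr_1 (V := R_NormedModule)).
  match goal with |- is_series _ ?x => replace x with
    (- Series (fun k => 2 / den alpha (k + 2) * (- r) ^ (k + 2))) end.
  - apply (is_series_ext (fun n => - (2 / den alpha (n + 2) * (- r) ^ (n + 2)))).
    + intros n. rewrite E. apply Ropp_involutive.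
    + apply (is_series_opp (V := R_NormedModule)). now apply Series_correct.
  - unfold plus, opp, tg_alt; simpl. ring.
Qed.

Lemma partial_continuity (alpha : R) (N : nat) :
  continuity (fun r => sum_f_R0 (tg_alt (fun n => altcoef alpha n * r ^ S n)) N).
Proof.
  induction N as [|N IH]; unfold tg_alt in *.
  - simpl. reg.
  - change (continuity (plus_fct (fun r => sum_f_R0 (fun i => (-1) ^ i * (altcoef alpha i * r ^ S i)) N)
      (fun r => (-1) ^ S N * (altcoef alpha (S N) * r ^ S (S N))))).
    apply continuity_plus; [exact IH|]. intros x. reg.
Qed.

(** Partial sums ending in a positive term lie above [growth] at each [x < 1]; by continuity those
    at 1 lie above [growth alpha s], and so does their limit. The intermediate point [s] makes the
    inequality strict. *)
Lemma growth_lt_rsum (alpha r : R) : 0 <= alpha -> 0 <= r < 1 -> growth alpha r < rsum alpha.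
Proof.
  intros Ha Hr. set (s := (1 + r) / 2).
  apply Rlt_le_trans with (growth alpha s); [apply growth_lt; unfold s; lra|].
  assert (HN : forall N, growth alpha s <= sum_f_R0 (tg_alt (fun n => altcoef alpha n * 1 ^ S n)) (2 * N)).
  { intros N. apply Ropp_le_cancel.
    apply (le_at_1 (fun x => - sum_f_R0 (tg_alt (fun n => altcoef alpha n * x ^ S n)) (2 * N)) s); [unfold s; lra| |].
    - apply continuity_pt_opp. apply partial_continuity.
    - intros x Hx. apply Ropp_le_contravar.
      apply Rle_trans with (growth alpha x); [left; apply growth_lt; unfold s in *; lra|].
      apply (alternated_series_ineq _ _ N (alternating_decr alpha x Ha ltac:(unfold s in *; lra))
        (alternating_cv_0 alpha x Ha ltac:(unfold s in *; lra)) (growth_cv alpha x Ha ltac:(unfold s in *; lra))). }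
  apply Rnot_lt_le. intros Hlt.
  destruct (alternating_cv alpha Ha (growth alpha s - rsum alpha)) as [N0 HN0]; [lra|].
  specialize (HN0 (2 * N0)%nat ltac:(lia)). unfold R_dist in HN0. apply Rabs_lt_between in HN0.
  specialize (HN N0). lra.
Qed.

(** The dual argument: an upper bound [w] for [growth] bounds the partial sums ending in a negative
    term at each [x < 1], hence at 1, hence their limit [rsum]. *)
Lemma growth_near_rsum (alpha w : R) : 0 <= alpha -> w < rsum alpha ->
  exists r, 0 <= r < 1 /\ w < growth alpha r.
Proof.
  intros Ha Hw. apply NNPP. intros Hno.
  assert (HN : forall N, sum_f_R0 (tg_alt (fun n => altcoef alpha n * 1 ^ S n)) (S (2 * N)) <= w).
  { intros N.
    apply (le_at_1 (fun x => sum_f_R0 (tg_alt (fun n => altcoef alpha n * x ^ S n)) (S (2 * N))) 0); [lra| |].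
    - apply partial_continuity.
    - intros x Hx. apply Rle_trans with (growth alpha x).
      + apply (alternated_series_ineq _ _ N (alternating_decr alpha x Ha ltac:(lra))
          (alternating_cv_0 alpha x Ha ltac:(lra)) (growth_cv alpha x Ha ltac:(lra))).
      + apply Rnot_lt_le. intros Hlt. apply Hno. exists x. split; [lra|assumption]. }
  destruct (alternating_cv alpha Ha (rsum alpha - w)) as [N0 HN0]; [lra|].
  specialize (HN0 (S (2 * N0)) ltac:(lia)). unfold R_dist in HN0. apply Rabs_lt_between in HN0.
  specialize (HN N0). lra.
Qed.

Lemma rsum_bounds (alpha : R) : 0 <= alpha -> 0 < rsum alpha < 1.
Proof.
  intros Ha. split.
  - rewrite <- (growth_0 alpha). apply growth_lt_rsum; lra.
  (* The first term gives only [rsum <= 1]; with three terms the strict decrease from index 1 to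
     index 2 takes effect. *)
  - apply Rle_lt_trans with (sum_f_R0 (tg_alt (fun n => altcoef alpha n * 1 ^ S n)) (2 * 1)).
    + apply (alternated_series_ineq _ _ 1 (alternating_decr alpha 1 Ha ltac:(lra))
        (alternating_cv_0 alpha 1 Ha ltac:(lra)) (alternating_cv alpha Ha)).
    + change (2 * 1)%nat with 2%nat. unfold tg_alt. cbn [sum_f_R0]. rewrite !pow1.
      generalize (altcoef_lt alpha 0 Ha). change (altcoef alpha 0) with 1. simpl pow. lra.
Qed.

Lemma lsum_root (alpha : R) : 0 <= alpha -> exists r, 0 < r < 1 /\ lsum alpha r = rsum alpha.
Proof.
  intros Ha. destruct (rsum_bounds alpha Ha) as [H0 H1]. set (c := rsum alpha) in *.
  assert (Hc : c <= lsum alpha c).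
  { rewrite lsum_eq by (try assumption; rewrite Rabs_pos_eq; lra).
    assert (0 <= Series (fun k => 2 / den alpha (k + 2) * c ^ (k + 2))); [|lra].
    rewrite <- Series_zero. apply Series_le.
    - intros n. split; [lra|]. replace (n + 2)%nat with (S (S n)) by lia. apply Rmult_le_pos.
      + left. apply Rdiv_lt_0_compat; [lra|now apply den_pos].
      + apply pow_le. lra.
    - apply ex_series_ext_coef; [assumption|]. rewrite Rabs_pos_eq; lra. }
  (* The interval stops short of 1, where the series diverges for [alpha = 0]. Since
     [c <= lsum alpha c], strict monotonicity gives the strict sign at the right endpoint. *)
  assert (Hlt := lsum_lt alpha c ((1 + c) / 2) Ha ltac:(lra) ltac:(lra)).
  destruct (Ranalysis5.IVT_interv (fun r => lsum alpha r - c) 0 ((1 + c) / 2)) as [r [Hr Er]].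
  - intros a Hr. apply continuity_pt_minus; [|apply continuity_pt_const; intros ? ?; reflexivity].
    apply derivable_continuous_pt.
    exists (Re (CPS (Cderiv_coef (ext_coef alpha)) (0 + RtoC a * RtoC 1)%C)).
    apply is_derive_Reals. apply is_derive_lsum; [assumption|lra].
  - lra.
  - rewrite lsum_0. lra.
  - lra.
  - exists r. split; [|lra].
    destruct (Rle_lt_or_eq_dec 0 r (proj1 Hr)) as [|<-]; [lra|]. rewrite lsum_0 in Er. lra.
Qed.

Lemma lsum_inj (alpha r s : R) : 0 <= alpha -> 0 < r < 1 -> 0 < s < 1 ->
  lsum alpha r = lsum alpha s -> r = s.
Proof.
  intros Ha Hr Hs E. destruct (Rtotal_order r s) as [H|[H|H]]; [|assumption|].
  - generalize (lsum_lt alpha r s Ha ltac:(lra) ltac:(lra)). lra.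
  - generalize (lsum_lt alpha s r Ha ltac:(lra) ltac:(lra)). lra.
Qed.

Lemma bohr_sum_le (alpha r : R) (a b : nat -> C) : 0 <= alpha -> in_W0H alpha a b -> 0 <= r < 1 ->
  bohr_sum a b r <= lsum alpha r.
Proof.
  intros Ha HW Hr. apply in_W0H_coef in HW.
  assert (Hr' : Rabs r < 1) by (rewrite Rabs_pos_eq; lra).
  rewrite lsum_eq by assumption. unfold bohr_sum. apply Rplus_le_compat_l.
  apply Series_le; [|now apply ex_series_ext_coef].
  intros n. replace (n + 2)%nat with (S (S n)) by lia.
  assert (Hp : 0 <= r ^ S (S n)) by (apply pow_le; lra).
  split.
  - apply Rmult_le_pos; [|assumption]. apply Rplus_le_le_0_compat; apply Cmod_ge_0.
  - apply Rmult_le_compat_r; [assumption|].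
    exact (W0H_coef_bound alpha (hcoef a) (gcoef b) n Ha HW).
Qed.

Lemma bohr_sum_ext (alpha r : R) : 0 <= alpha -> 0 <= r < 1 ->
  bohr_sum (a_ext alpha) b_ext r = lsum alpha r.
Proof.
  intros Ha Hr. rewrite lsum_eq by (try assumption; rewrite Rabs_pos_eq; lra).
  unfold bohr_sum. f_equal. apply Series_ext. intros n. f_equal.
  unfold a_ext, b_ext. rewrite Cmod_0, Cmod_R, Rplus_0_r. apply Rabs_pos_eq.
  replace (n + 2)%nat with (S (S n)) by lia. left. apply Rdiv_lt_0_compat; [lra|now apply den_pos].
Qed.

Lemma ffun_0 (a b : nat -> C) : ffun a b (RtoC 0) = RtoC 0.
Proof.
  change (ffun a b (RtoC 0)) with (CPS (hcoef a) (RtoC 0) + Cconj (CPS (gcoef b) (RtoC 0)))%C.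
  rewrite !CPS_0. apply C_eq; simpl; ring.
Qed.

Lemma dist_bd_ge (alpha : R) (a b : nat -> C) : 0 <= alpha -> in_W0H alpha a b ->
  Rbar_le (rsum alpha) (dist_bd (ffun a b)).
Proof.
  intros Ha HW. apply in_W0H_coef in HW.
  (* The bound is proved for each boundary point, which also covers an empty boundary, where the
     infimum is [+oo]. *)
  apply (proj2 (Glb_Rbar_correct _)). intros x [w [Hw ->]]. simpl.
  rewrite ffun_0. replace (w - 0)%C with w by ring.
  apply Rnot_lt_le. intros Hlt.
  destruct (Hw (rsum alpha - Cmod w)) as [_ [t [Ht Htw]]]; [lra|].
  apply Ht.
  assert (Hm : Cmod t < rsum alpha).
  { generalize (Cmod_triangle w (t - w)). replace (w + (t - w))%C with t by ring. lra. }
  destruct (growth_near_rsum alpha (Cmod t) Ha Hm) as [r [Hr Hg]].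
  destruct (W0H_image alpha _ _ r t Ha HW Hr Hg) as [z [Hz E]].
  exists z. split; [assumption|]. symmetry. exact E.
Qed.

(* [Im f] vanishes only on the real axis, because [t |-> Im f (x + i t)] has derivative [Re f' > 0]. *)
Lemma ext_im_sign (alpha : R) (z : C) : 0 <= alpha -> inD z -> Im z <> 0 ->
  0 < Im z * Im (CPS (ext_coef alpha) z).
Proof.
  intros Ha Hz Hy. destruct z as [x y]. simpl in Hy. change (Im (x, y)) with y.
  (* [e] is the vertical displacement from the real axis to [z], and [Re (w * p) = y * Im p], which
     is 0 at the real starting point. *)
  set (e := (0, y) : C). set (w := (0, - y) : C).
  assert (Hin : forall t, 0 <= t <= 1 -> inD (RtoC x + RtoC t * e)%C).
  { intros t Ht. unfold inD in *. apply Rle_lt_trans with (2 := Hz).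
    apply sqrt_le_1_alt. simpl.
    assert (Hy2 : 0 <= y * y) by nra. assert (Ht2 : t * t <= 1) by nra.
    generalize (Rmult_le_compat_r _ _ _ Hy2 Ht2). lra. }
  assert (H : Re (w * CPS (ext_coef alpha) (RtoC x + RtoC 0 * e)%C) < Re (w * CPS (ext_coef alpha) (RtoC x + RtoC 1 * e)%C)).
  { apply (pos_derive_lt (fun t => Re (w * CPS (ext_coef alpha) (RtoC x + RtoC t * e)%C))
      (fun t => Re (w * (e * CPS (Cderiv_coef (ext_coef alpha)) (RtoC x + RtoC t * e)%C)))); [lra| |].
    - intros t Ht. apply is_derive_line. apply is_derive_CPS; [now apply disk_summable_ext|]. now apply Hin.
    - intros t Ht. generalize (re_deriv_ext_pos alpha _ Ha (Hin t Ht)).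
      destruct (CPS _ _) as [p q]. unfold w, e. simpl. assert (0 < y * y) by nra. intros Hp.
      match goal with |- 0 < ?g => replace g with (y * y * p) by ring end.
      now apply Rmult_lt_0_compat. }
  replace (RtoC x + RtoC 1 * e)%C with ((x, y) : C) in H by (apply C_eq; unfold e; simpl; ring).
  replace (RtoC x + RtoC 0 * e)%C with (RtoC x) in H by ring.
  rewrite CPS_ext_real in H.
  - destruct (CPS (ext_coef alpha) (x, y)) as [p q]. unfold w in H. simpl in H |- *. lra.
  - assumption.
  - unfold inD in Hz. apply Rle_lt_trans with (2 := Hz). exact (re_le_Cmod (x, y)).
Qed.

(** On the real axis, points [x >= 0] have values at least 0, and points [x < 0] have the value
    [- growth alpha (- x)], which stays above [- rsum alpha]. *)
Lemma ext_omits (alpha : R) (z : C) : 0 <= alpha -> inD z ->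
  CPS (ext_coef alpha) z <> RtoC (- rsum alpha).
Proof.
  intros Ha Hz E. destruct (Req_dec (Im z) 0) as [Hy|Hy].
  - destruct z as [x y]. simpl in Hy. subst y. change ((x, 0) : C) with (RtoC x) in *.
    unfold inD in Hz. rewrite Cmod_R in Hz. assert (Hx := proj1 (Rabs_lt_between _ _) Hz).
    destruct (Rle_lt_dec 0 x) as [H0|H0].
    + assert (H1 : 0 <= lsum alpha x).
      { destruct (Rle_lt_or_eq_dec 0 x H0) as [H|<-]; [|rewrite lsum_0; lra].
        left. rewrite <- (lsum_0 alpha). apply lsum_lt; lra. }
      unfold lsum in H1. replace (0 + RtoC x * RtoC 1)%C with (RtoC x) in H1 by ring.
      rewrite E in H1. simpl in H1. generalize (rsum_bounds alpha Ha). lra.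
    + assert (H1 := growth_lt_rsum alpha (- x) Ha ltac:(lra)). unfold growth in H1.
      replace (0 + RtoC (- x) * RtoC (-1))%C with (RtoC x) in H1 by (apply C_eq; simpl; ring).
      rewrite E in H1. simpl in H1. lra.
  - generalize (ext_im_sign alpha z Ha Hz Hy). rewrite E. simpl. lra.
Qed.

Lemma dist_bd_ext (alpha : R) : 0 <= alpha -> dist_bd (ffun (a_ext alpha) b_ext) = rsum alpha.
Proof.
  intros Ha. apply Rbar_le_antisym; [|apply dist_bd_ge; [assumption|now apply coef_in_W0H, W0H_coef_ext]].
  destruct (rsum_bounds alpha Ha) as [H0 H1].
  apply (proj1 (Glb_Rbar_correct _)). exists (RtoC (- rsum alpha)). split.
  - intros eps Heps. split.
    + destruct (growth_near_rsum alpha (rsum alpha - eps) Ha) as [r [Hr Hg]]; [lra|].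
      assert (Hr' : Rabs (- r) < 1) by (rewrite Rabs_Ropp, Rabs_pos_eq; lra).
      exists (RtoC (- growth alpha r)). split.
      * exists (RtoC (- r)). assert (Hin : inD (RtoC (- r))) by (unfold inD; now rewrite Cmod_R).
        split; [assumption|]. rewrite ffun_ext by assumption. unfold growth.
        replace (0 + RtoC r * RtoC (-1))%C with (RtoC (- r)) by (apply C_eq; simpl; ring).
        rewrite CPS_ext_real by assumption. change (Re (RtoC ?x)) with x. now rewrite Ropp_involutive.
      * rewrite <- RtoC_minus, Cmod_R. assert (Hlt := growth_lt_rsum alpha r Ha Hr).
        rewrite Rabs_pos_eq; lra.
    + exists (RtoC (- rsum alpha)). split.
      * intros [z [Hz E]]. rewrite ffun_ext in E by assumption.
        now apply (ext_omits alpha z Ha Hz).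
      * rewrite <- RtoC_minus, Cmod_R, Rminus_diag, Rabs_R0. assumption.
  - rewrite ffun_0. rewrite <- RtoC_minus, Cmod_R, Rminus_0_r, Rabs_Ropp, Rabs_pos_eq; lra.
Qed.

Theorem theorem2p4 (alpha : R) (halpha : 0 <= alpha) :
  (exists! r, 0 < r < 1 /\ rf_eq alpha r) /\
  forall rf : R, 0 < rf < 1 -> rf_eq alpha rf ->
    (forall a b : nat -> C, in_W0H alpha a b ->
       forall z : C, Cmod z <= rf ->
         Rbar_le (Finite (bohr_sum a b (Cmod z))) (dist_bd (ffun a b))) /\
    in_W0H alpha (a_ext alpha) b_ext /\
    (forall z : C, Cmod z = rf ->
       Finite (bohr_sum (a_ext alpha) b_ext (Cmod z)) = dist_bd (ffun (a_ext alpha) b_ext)) /\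
    (forall z : C, rf < Cmod z < 1 ->
       Rbar_lt (dist_bd (ffun (a_ext alpha) b_ext)) (Finite (bohr_sum (a_ext alpha) b_ext (Cmod z)))).
Proof.
  assert (Heq : forall r, 0 < r < 1 -> (rf_eq alpha r <-> lsum alpha r = rsum alpha))
    by (intros r Hr; apply rf_eq_lsum; [assumption|rewrite Rabs_pos_eq; lra]).
  split.
  - destruct (lsum_root alpha halpha) as [r [Hr Er]]. exists r. split.
    + split; [assumption|]. now apply Heq.
    + intros s [Hs Es]. apply Heq in Es; [|assumption].
      apply (lsum_inj alpha); try assumption. now rewrite Er, Es.
  - intros rf Hrf Erf. apply Heq in Erf; [|assumption]. split; [|split; [|split]].
    + intros a b HW z Hz. assert (Hz0 := Cmod_ge_0 z).
      apply Rbar_le_trans with (rsum alpha); [|now apply dist_bd_ge].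
      simpl. rewrite <- Erf. apply Rle_trans with (lsum alpha (Cmod z)).
      * apply bohr_sum_le; [assumption|assumption|lra].
      * destruct (Rle_lt_or_eq_dec _ _ Hz) as [Hlt|E]; [left; apply lsum_lt; lra|rewrite E; lra].
    + now apply coef_in_W0H, W0H_coef_ext.
    + intros z Hz. rewrite dist_bd_ext, bohr_sum_ext, Hz, Erf by (assumption || (rewrite Hz; lra) || lra).
      reflexivity.
    + intros z Hz. rewrite dist_bd_ext, bohr_sum_ext by (assumption || lra).
      simpl. rewrite <- Erf. apply lsum_lt; lra.
Qed.
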